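(* Let $X,Y$ be finite, $\mu,\nu$ with full support, $c:X\times Y\to\mathbb{R}$, $\varepsilon>0$, and let $\varphi_1,\varphi_2$ be entropy functions each of which is non-negative, finite on $[0,\infty)$, and continuously differentiable on the interior of its domain. Let $\{X_i\}_{i\in I}$ be a basic partition of $X$. Consider the following weight functions, where for input $((\pi_J)_{J\in\mathcal{J}},(\tilde\pi_J)_{J\in\mathcal{J}})$ the score produced by weights $(\theta_J)_J$ is $E\left(\sum_{J\in\mathcal{J}}(1-\theta_J)\pi_J+\theta_J\tilde\pi_J\right)$: 1. $\mathrm{GetWeights}_{\mathrm{safe}}\equiv(1/|\mathcal{J}|,\dots,1/|\mathcal{J}|)$, regardless of the input. 2. $\mathrm{GetWeights}_{\mathrm{swift}}$: choose between $(\theta_J)_{J\in\mathcal{J}}=(1/|\mathcal{J}|,\dots,1/|\mathcal{J}|)$ and $(\theta_J)_{J\in\mathcal{J}}=(1,\dots,1)$ the one that produces the larger decrement of the score. 3. $\mathrm{GetWeights}_{\mathrm{opt}}$: choose $(\theta_J)_{J\in\mathcal{J}}\in[0,1]^{|\mathcal{J}|}$ producing the best possible decrement of the score (i.e. the minimal score). 4. $\mathrm{GetWeights}_{\mathrm{line}}$: choose $(\theta_J)_{J\in\mathcal{J}}=(\zeta,\dots,\zeta)$ where the scalar $\zeta\in[1/|\mathcal{J}|,1]$ optimizes the decrement of the score. Then: (a) $\mathrm{GetWeights}_{\mathrm{safe}}$ is continuous, and for every plan $\pi\in\mathcal{M}_+(X\times Y)$ and every composite partition $\mathcal{J}$, with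 $\pi_J=\pi\llcorner(X_J\times Y)$, $\tilde\pi_J=S_J(\pi)$ and $(\theta_J)_J=\mathrm{GetWeights}_{\mathrm{safe}}((\pi_J)_J,(\tilde\pi_J)_J)$, the updated plan $\bar\pi=\sum_{J\in\mathcal{J}}(1-\theta_J)\pi_J+\theta_J\tilde\pi_J$ satisfies $E(\bar\pi)<E(\pi)$ unless $\pi_J=\tilde\pi_J$ for all $J\in\mathcal{J}$. (b) For $\mathrm{GetWeights}\in\{\mathrm{GetWeights}_{\mathrm{swift}},\mathrm{GetWeights}_{\mathrm{opt}},\mathrm{GetWeights}_{\mathrm{line}}\}$, for every $\pi$, $\mathcal{J}$, $(\pi_J)_J$, $(\tilde\pi_J)_J$ as in (a), the score of the updated plan obtained with $\mathrm{GetWeights}$ is less than or equal to the score of the updated plan obtained with $\mathrm{GetWeights}_{\mathrm{safe}}$. (c) As a consequence, for any of the four choices of weight function, any two composite partitions $\mathcal{J}_A,\mathcal{J}_B$ and any $\pi_{\mathrm{init}}\in\mathcal{M}_+(X\times Y)$ with $E(\pi_{\mathrm{init}})<\infty$, the parallel unbalanced domain decomposition algorithm (defined in the context) is convergent: its iterates $(\pi^k)_k$ converge to the globally optimal solution of $\inf_{\pi\in\mathcal{M}_+(X\times Y)}E(\pi)$.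
   Context: $\mathcal{M}_+(Z)$ denotes the non-negative finite measures on $Z$. $\langle\phi,\rho\rangle$ is the integral of $\phi$ against $\rho$; $\pi\llcorner S$ is the restriction of $\pi$ to $S$. $\mathrm{P}_X,\mathrm{P}_Y$ are the marginal projections: $(\mathrm{P}_X\pi)(A)=\pi(A\times Y)$, $(\mathrm{P}_Y\pi)(B)=\pi(X\times B)$. $\mu\in\mathcal{M}_+(X)$, $\nu\in\mathcal{M}_+(Y)$. An entropy function is a lower semicontinuous convex function $\varphi:\mathbb{R}\to\mathbb{R}\cup\{\infty\}$ with $\mathrm{dom}(\varphi)\subseteq[0,\infty)$ and $\mathrm{dom}(\varphi)\setminus\{0\}\neq\emptyset$. Set $\varphi'_\infty=\lim_{x\to+\infty}\varphi(x)/x$. The associated divergence is $D_\varphi(\rho\mid\sigma)=\int_Z\varphi\left(\frac{\mathrm{d}\rho}{\mathrm{d}\sigma}\right)\mathrm{d}\sigma+\varphi'_\infty\,\rho^\perp(Z)$, where $\rho=\frac{\mathrm{d}\rho}{\mathrm{d}\sigma}\sigma+\rho^\perp$ is the Lebesgue decomposition. Write $D_1=D_{\varphi_1}$, $D_2=D_{\varphi_2}$. For $\rho\ll\sigma$, $\mathrm{KL}(\rho\mid\sigma)=\int\left[\frac{\mathrm{d}\rho}{\mathrm{d}\sigma}\log\frac{\mathrm{d}\rho}{\mathrm{d}\sigma}-\frac{\mathrm{d}\rho}{\mathrm{d}\sigma}+1\right]\mathrm{d}\sigma$ (with $0\log 0=0$), and $+\infty$ otherwise. Global objective (score): $$E(\pi)=\langle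 c,\pi\rangle+\varepsilon\,\mathrm{KL}(\pi\mid\mu\otimes\nu)+D_1(\mathrm{P}_X\pi\mid\mu)+D_2(\mathrm{P}_Y\pi\mid\nu).$$ A basic partition $\{X_i\}_{i\in I}$ ($I$ finite) is a partition of $X$ into closed, $\mu$-essentially disjoint subsets with $\mu(X_i)>0$ for all $i$. A composite partition $\mathcal{J}$ is a partition of $I$; for $J\in\mathcal{J}$ the composite cell is $X_J=\bigcup_{i\in J}X_i$ and $\mu_J=\mu\llcorner X_J$. $|\mathcal{J}|$ is the number of composite cells. Cell objective, for $\nu_{-J}\in\mathcal{M}_+(Y)$ and $\pi_J\in\mathcal{M}_+(X_J\times Y)$: $$E_J(\pi_J\mid\nu_{-J})=\langle c,\pi_J\rangle+\varepsilon\,\mathrm{KL}(\pi_J\mid\mu_J\otimes\nu)+D_1(\mathrm{P}_X\pi_J\mid\mu_J)+D_2(\mathrm{P}_Y\pi_J+\nu_{-J}\mid\nu).$$ In this setting it has a unique minimizer over $\mathcal{M}_+(X_J\times Y)$. The cell solution map is $$S_J(\pi)=\operatorname*{argmin}_{\hat\pi_J\in\mathcal{M}_+(X_J\times Y)}E_J\left(\hat\pi_J\,\middle|\,\mathrm{P}_Y[\pi\llcorner((X\setminus X_J)\times Y)]\right).$$ A weight function $\mathrm{GetWeights}$ assigns, for each composite partition $\mathcal{J}$, to a pair of families $(\pi_J)_{J\in\mathcal{J}},(\tilde\pi_J)_{J\in\mathcal{J}}$ with $\pi_J,\tilde\pi_J\in\mathcal{M}_+(X_J\times Y)$ a vector $(\theta_J)_{J\in\mathcal{J}}\in[0,1]^{\mathcal{J}}$.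 Where a weight function is described by an optimization, any optimal choice may be taken. Parallel unbalanced domain decomposition algorithm with weight function $\mathrm{GetWeights}$: set $\pi^0=\pi_{\mathrm{init}}$. For $k=1,2,\dots$, let $\mathcal{J}=\mathcal{J}_A$ if $k$ is odd and $\mathcal{J}=\mathcal{J}_B$ if $k$ is even. For all $J\in\mathcal{J}$ set $\pi_J=\pi^{k-1}\llcorner(X_J\times Y)$ and $\tilde\pi_J=S_J(\pi^{k-1})$. Compute $(\theta_J)_J=\mathrm{GetWeights}((\pi_J)_J,(\tilde\pi_J)_J)$ and set $\pi^k=\sum_{J\in\mathcal{J}}(1-\theta_J)\pi_J+\theta_J\tilde\pi_J$. *)

(* Defs.v *)
From HB Require Import structures.
From mathcomp Require Import all_boot all_order all_algebra.
From mathcomp Require Import all_classical all_reals all_analysis.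

Set Implicit Arguments.
Unset Strict Implicit.
Unset Printing Implicit Defensive.

Import Order.TTheory GRing.Theory Num.Theory.
Import numFieldNormedType.Exports.

Local Open Scope classical_set_scope.
Local Open Scope ring_scope.

(* A finite measure on the finite set Z is represented by its mass function
   rho : Z -> R, where rho z is the measure of the singleton z; weak convergence
   of measures is then pointwise convergence, and every subset of Z is closed. *)
Section Measures.
Variables (R : realType) (Z : finType).
Implicit Types (rho sigma : Z -> R) (S A : {set Z}).

Definition Mplus : set (Z -> R) := [set rho | forall z, 0 <= rho z].

(* Measures on the subset S, seen as measures on Z that do not charge the
   complement of S. *)
Definition Mplus_on S : set (Z -> R) :=
  [set rho | Mplus rho /\ forall z, z \notin S -> rho z = 0].

Definition mass rho A : R := \sum_(z in A) rho z.

Definition full_support rho := forall z, 0 < rho z.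

Definition integral_against (f : Z -> R) rho : R := \sum_z f z * rho z.

Definition restriction rho S : Z -> R := fun z => if z \in S then rho z else 0.

Definition abs_cont rho sigma : bool :=
  [forall A : {set Z}, (mass sigma A == 0) ==> (mass rho A == 0)].

(* Lebesgue decomposition; the density is only relevant where sigma does not
   vanish, elsewhere x / 0 = 0 makes it zero. *)
Definition density rho sigma : Z -> R := fun z => rho z / sigma z.
Definition singular_part rho sigma : Z -> R :=
  fun z => if sigma z == 0 then rho z else 0.

Lemma lebesgue_decomposition rho sigma z :
  rho z = density rho sigma z * sigma z + singular_part rho sigma z.
Proof.
rewrite /density /singular_part; case: (eqVneq (sigma z) 0) => [->|s0].
  by rewrite mulr0 add0r.
by rewrite mulfVK // addr0.
Qed.

Lemma singular_part_singular rho sigma : exists A : {set Z},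
  mass sigma A = 0 /\ mass (singular_part rho sigma) (~: A)%SET = 0.
Proof.
exists [set z | sigma z == 0]%SET; split; apply: big1 => z; rewrite !inE.
  by move/eqP.
by rewrite /singular_part => /negbTE ->.
Qed.

(* ln 0 = 0 in the library, hence 0 * ln 0 = 0. *)
Definition KL rho sigma : \bar R :=
  if abs_cont rho sigma then
    (\sum_z (density rho sigma z * ln (density rho sigma z)
             - density rho sigma z + 1) * sigma z)%:E
  else +oo%E.

End Measures.

Section Entropy.
Variable R : realType.
Implicit Type phi : R -> \bar R.
Local Open Scope ereal_scope.

Definition edom phi : set R := [set x | phi x < +oo].

Record entropy_function phi : Prop := EntropyFunction {
  entropy_gtNy : forall x, -oo < phi x ;
  entropy_lsc : lower_semicontinuous phi ;
  entropy_convex : forall (x y t : R), (0 <= t <= 1)%R ->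
    phi (t * x + (1 - t) * y)%R <= t%:E * phi x + (1 - t)%:E * phi y ;
  entropy_dom : forall x, edom phi x -> (0 <= x)%R ;
  entropy_dom_neq0 : exists2 x, edom phi x & x != 0%R
}.

Definition nonnegative phi := forall x, 0 <= phi x.

Definition finite_on_nonneg phi := forall x, (0 <= x)%R -> phi x \is a fin_num.

Definition C1_on_interior_dom phi :=
  forall x : R, interior (edom phi) x ->
    derivable (fine \o phi) x 1 /\ {for x, continuous (derive1 (fine \o phi))}.

Definition recession phi : \bar R := lim (phi x * (x^-1)%:E @[x --> +oo%R]).

Definition divergence (Z : finType) phi (rho sigma : Z -> R) : \bar R :=
  \sum_z phi (density rho sigma z) * (sigma z)%:E
  + recession phi * (mass (singular_part rho sigma) [set: Z]%SET)%:E.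

End Entropy.

Definition argmin (R : realType) (T : Type) (F : T -> \bar R) (A : set T)
  : set T := [set p | A p /\ forall q, A q -> (F p <= F q)%E].

Section Couplings.
Variables (R : realType) (X Y : finType).

Definition marginalX (pi : X * Y -> R) : X -> R := fun x => \sum_y pi (x, y).
Definition marginalY (pi : X * Y -> R) : Y -> R := fun y => \sum_x pi (x, y).

Definition product_measure (mu : X -> R) (nu : Y -> R) : X * Y -> R :=
  fun z => mu z.1 * nu z.2.

Definition cylinder (S : {set X}) : {set X * Y} := finset.setX S [set: Y]%SET.

Definition objective (c : X * Y -> R) (eps : R) (mu : X -> R) (nu : Y -> R)
    (phi1 phi2 : R -> \bar R) (pi : X * Y -> R) : \bar R :=
  ((integral_against c pi)%:E + eps%:E * KL pi (product_measure mu nu)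
   + divergence phi1 (marginalX pi) mu + divergence phi2 (marginalY pi) nu)%E.

End Couplings.

Section DomainDecomposition.
Variables (R : realType) (X Y I : finType).
Variables (c : X * Y -> R) (eps : R) (mu : X -> R) (nu : Y -> R).
Variables (phi1 phi2 : R -> \bar R) (Xi : I -> {set X}).
Implicit Types (pi : X * Y -> R) (JJ : {set {set I}}).

Local Notation E := (objective c eps mu nu phi1 phi2).

Definition basic_partition : Prop :=
  [/\ (\bigcup_(i : I) Xi i)%SET = [set: X]%SET,
      forall i j, i != j -> mass mu (Xi i :&: Xi j)%SET = 0 &
      forall i, 0 < mass mu (Xi i)].

Definition composite_partition JJ : bool := finset.partition JJ [set: I]%SET.

Definition composite_cell (J : {set I}) : {set X} := (\bigcup_(i in J) Xi i)%SET.

Definition cell_objective (J : {set I}) (nuJ : Y -> R) pi : \bar R :=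
  let muJ := restriction mu (composite_cell J) in
  ((integral_against c pi)%:E + eps%:E * KL pi (product_measure muJ nu)
   + divergence phi1 (marginalX pi) muJ
   + divergence phi2 (fun y => marginalY pi y + nuJ y)%R nu)%E.

(* The minimizer exists and is unique in the setting of the theorem, so the
   default value of xget is not used there. *)
Definition cell_solution (J : {set I}) pi : X * Y -> R :=
  let nuJ := marginalY (restriction pi (cylinder Y (~: composite_cell J)%SET)) in
  xget (fun=> 0)
    (argmin (cell_objective J nuJ) (Mplus_on (cylinder Y (composite_cell J)))).

Definition cells JJ : Type := {J : {set I} | J \in JJ}.

Definition plan_family JJ : Type := cells JJ -> X * Y -> R.

Definition admissible JJ (p : plan_family JJ) : Prop :=
  forall J : cells JJ, Mplus_on (cylinder Y (composite_cell (val J))) (p J).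

Definition cell_restrictions JJ pi : plan_family JJ :=
  fun J => restriction pi (cylinder Y (composite_cell (val J))).

Definition cell_solutions JJ pi : plan_family JJ :=
  fun J => cell_solution (val J) pi.

Arguments cell_restrictions JJ pi _ _ : clear implicits.
Arguments cell_solutions JJ pi _ _ : clear implicits.

Definition updated_plan JJ (p pt : plan_family JJ) (theta : cells JJ -> R)
  : X * Y -> R :=
  fun z => \sum_(J : cells JJ) ((1 - theta J) * p J z + theta J * pt J z).

Definition weight_function : Type :=
  forall JJ, plan_family JJ -> plan_family JJ -> cells JJ -> R.

Definition weights_safe : weight_function := fun JJ _ _ _ => #|JJ|%:R^-1.

Definition weights_one JJ : cells JJ -> R := fun=> 1.

(* The other weight functions are any selection of an optimal choice, so they
   are characterized by predicates. Since E of the current plan does not depend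
   on the weights, the largest decrement is the smallest score. *)
Definition is_weights_swift (GW : weight_function) : Prop :=
  forall JJ (p pt : plan_family JJ), composite_partition JJ ->
    admissible p -> admissible pt ->
    argmin (fun theta => E (updated_plan p pt theta))
      [set weights_safe p pt; @weights_one JJ] (GW JJ p pt).

Definition is_weights_opt (GW : weight_function) : Prop :=
  forall JJ (p pt : plan_family JJ), composite_partition JJ ->
    admissible p -> admissible pt ->
    argmin (fun theta => E (updated_plan p pt theta))
      [set theta : cells JJ -> R | forall J, 0 <= theta J <= 1] (GW JJ p pt).

Definition is_weights_line (GW : weight_function) : Prop :=
  forall JJ (p pt : plan_family JJ), composite_partition JJ ->
    admissible p -> admissible pt ->
    argmin (fun theta => E (updated_plan p pt theta))
      [set theta : cells JJ -> R |
        exists2 zeta : R, #|JJ|%:R^-1 <= zeta <= 1 & theta = fun=> zeta]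
      (GW JJ p pt).

Definition next_plan (GW : weight_function) JJ pi : X * Y -> R :=
  let p := cell_restrictions JJ pi in
  let pt := cell_solutions JJ pi in
  updated_plan p pt (GW JJ p pt).

Fixpoint iterates (GW : weight_function) (JA JB : {set {set I}})
    (pi_init : X * Y -> R) (k : nat) : X * Y -> R :=
  if k is k'.+1 then
    next_plan GW (if odd k then JA else JB) (iterates GW JA JB pi_init k')
  else pi_init.

Definition continuous_weights (GW : weight_function) : Prop :=
  forall JJ, composite_partition JJ ->
    {within [set q : {ptws cells JJ -> {ptws X * Y -> R}} *
                     {ptws cells JJ -> {ptws X * Y -> R}} |
             admissible q.1 /\ admissible q.2],
      continuous ((fun q => GW JJ q.1 q.2) :
        {ptws cells JJ -> {ptws X * Y -> R}} *
        {ptws cells JJ -> {ptws X * Y -> R}} -> {ptws cells JJ -> R})}.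

End DomainDecomposition.

Arguments cell_restrictions {R X Y I} Xi JJ pi _ _.
Arguments cell_solutions {R X Y I} c eps mu nu phi1 phi2 Xi JJ pi _ _.
Arguments weights_safe {R X Y I} JJ _ _ _.

(* Main.v *)
Require Import Defs.
From mathcomp Require Import all_boot all_order all_algebra.
From mathcomp Require Import all_classical all_reals all_analysis.
From mathcomp Require Import ring lra.

(** Restricted to non-negative plans the objective is a real number, [score pi]:
    a linear term, the relative entropy, and convex functions of the marginals
    ([objectiveE]). The entropy generator t ln t - t + 1 lies strictly above its
    tangents ([ent_tangent]), which makes the score strictly convex
    ([score_strict_convex]) with compact sublevel sets ([sublevel_compact]).
    Hence it has exactly one minimizer on every nonempty closed convex set of
    plans ([minimizer_closed_convex]). On the set of all plans this is the limit
    of the algorithm. On the set of plans that agree with pi off a cell, it is pi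
    overwritten by the cell solution, because there the cell objective differs
    from the score by a constant ([cell_objectiveE], [cell_solutionP]).

    The plan updated with equal weights 1/n is the average of the n plans obtained
    by solving a single cell ([next_safe_average]). By convexity the step lowers
    the score by at least 1/n of what overwriting any one cell of pi by any plan
    would gain ([next_safe_gain]). A cell where pi differs from the cell solution
    gives a strict decrease. The other weights minimize the score over sets that
    contain the equal weights, so they lower it at least as much.

    For the convergence one needs that a plan p which is not optimal can be
    improved inside a single cell ([blockwise_descent]). If p vanishes somewhere,
    raising that entry helps, as the entropy has slope -oo at 0. If p is positive,
    the score is differentiable at p and its derivative towards a better plan is
    negative; it is the sum of the derivatives along the restrictions of that
    direction to the cells, so one of those is negative. Overwriting a cell by a
    fixed plan gains an amount that depends continuously on the current plan, so a
    step from anywhere near p gains at least some d > 0 ([uniform_block_gain]). The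
    scores of the iterates decrease to a limit, so the gains tend to 0 and the
    iterates cannot accumulate at p. They stay in a compact sublevel set, hence
    accumulate at the optimum; being a strict minimum over a compact set, it
    attracts the whole sequence ([descent_converges]). *)

Set Implicit Arguments.
Unset Strict Implicit.
Unset Printing Implicit Defensive.

Import Order.TTheory GRing.Theory Num.Theory.
Import numFieldNormedType.Exports.

Local Open Scope classical_set_scope.
Local Open Scope ring_scope.

(** * Convex functions on the half-line and the entropy generator *)

Section HalfLine.
Variable R : realType.
Implicit Types (f : R -> R) (a b s t w : R).

Definition convex_nonneg f := forall a b t, 0 <= a -> 0 <= b -> 0 <= t <= 1 ->
  f (t * a + (1 - t) * b) <= t * f a + (1 - t) * f b.

(** Extending [f] by its value at 0 to the negative axis turns continuity on the
    half-line into continuity on the whole line. *)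
Definition clamp f t := f (Num.max t 0).

Lemma clampE f t : 0 <= t -> clamp f t = f t.
Proof. by move=> t0; rewrite /clamp max_l. Qed.

Lemma convex_clamp f : convex_nonneg f -> convex_nonneg (clamp f).
Proof.
move=> fc a b t a0 b0 /[dup] t01 /andP[t0 t1].
rewrite !clampE ?addr_ge0 ?mulr_ge0 ?subr_ge0 //.
exact: fc.
Qed.

Lemma convex_chord f s : convex_nonneg f -> 0 <= s <= 1 ->
  f s <= f 0 + s * (f 1 - f 0).
Proof.
move=> fc s01; have := fc 1 0 s ler01 (lexx _) s01.
by rewrite mulr1 mulr0 addr0 => /le_trans; apply; lra.
Qed.

Lemma continuous_clamp f : convex_nonneg f ->
  (forall t, 0 < t -> derivable f t 1) ->
  (forall e, 0 < e ->
     exists2 d, 0 < d & forall t, 0 <= t < d -> f 0 - e < f t) ->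
  continuous (clamp f).
Proof.
move=> fc fd flsc t; have [t0|t0|->] := ltgtP t 0.
- have H : \forall s \near t, clamp f 0 = clamp f s.
    near=> s; have s0 : s < 0 by near: s; exact: lt_nbhsl.
    by rewrite /clamp maxxx max_r // ltW.
  rewrite /continuous_at.
  have -> : clamp f t = clamp f 0 by rewrite /clamp maxxx max_r // ltW.
  by apply: cvg_trans (near_eq_cvg H) _; exact: cvg_cst.
- have H : \forall s \near t, f s = clamp f s.
    near=> s; have s0 : 0 < s by near: s; exact: lt_nbhsr.
    by rewrite clampE // ltW.
  rewrite /continuous_at clampE ?(ltW t0) //.
  apply: cvg_trans (near_eq_cvg H) _.
  by have /derivable1_diffP/differentiable_continuous := fd t t0.
- apply/cvgrPdist_lt => e e0.
  (* At the origin, semicontinuity bounds f from below and the chord from 0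
     to 1 bounds it from above. *)
  have [d d0 Hd] := flsc e e0.
  set C := `|f 1 - f 0| + 1.
  have C0 : 0 < C by rewrite ltr_wpDl.
  near=> x.
  have xd : `|x| < d.
    by near: x; exact: (@nbhs0_lt _ R^o d d0).
  have x1 : `|x| < 1 by near: x; exact: (@nbhs0_lt _ R^o 1 ltr01).
  have xe : `|x| < e / C.
    by near: x; exact: (@nbhs0_lt _ R^o _ (divr_gt0 e0 C0)).
  rewrite /clamp maxxx; set s := Num.max x 0.
  have s0 : 0 <= s by rewrite le_max lexx orbT.
  have sx : s <= `|x| by rewrite ge_max ler_norm normr_ge0.
  have := Hd s; rewrite s0 (le_lt_trans sx xd) => /(_ isT) H1.
  have H2 : f s <= f 0 + s * (f 1 - f 0).
    by apply: convex_chord; rewrite // s0 (le_trans sx (ltW x1)).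
  have H3 : s * (f 1 - f 0) < e.
    apply: (@le_lt_trans _ _ (s * C)).
      by rewrite ler_wpM2l // (le_trans (ler_norm _)) // lerDl.
    by rewrite -ltr_pdivlMr // (le_lt_trans sx).
  by rewrite distrC ltr_norml; apply/andP; split; lra.
Unshelve. all: by end_near. Qed.

(** [f (a / w) * w] is the contribution to a divergence of a point that carries
    mass [a] against the reference mass [w]. *)
Lemma perspective_convex f w a b t :
  convex_nonneg f -> 0 < w -> 0 <= a -> 0 <= b -> 0 <= t <= 1 ->
  clamp f ((t * a + (1 - t) * b) / w) * w <=
  t * (clamp f (a / w) * w) + (1 - t) * (clamp f (b / w) * w).
Proof.
move=> fc w0 a0 b0 t01; rewrite !mulrA -mulrDl ler_pM2r // mulrDl -!mulrA.
by apply: (convex_clamp fc) => //; rewrite divr_ge0 // ltW.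
Qed.

(** Chord slopes of a convex function are monotone, so its increments over a unit
    step control those over shorter ones, also from the boundary point 0. *)
Lemma perspective_slope f w a t :
  convex_nonneg f -> 0 < w -> 0 <= a -> 0 <= t <= w ->
  clamp f ((a + t) / w) * w <=
  clamp f (a / w) * w + t * (clamp f (a / w + 1) - clamp f (a / w)).
Proof.
move=> fc w0 a0 /andP[t0 tw].
have aw0 : 0 <= a / w by rewrite divr_ge0 // ltW.
have aw1 : 0 <= a / w + 1 by rewrite addr_ge0.
have tw01 : 0 <= t / w <= 1.
  by rewrite divr_ge0 ?(ltW w0) //= ler_pdivrMr // mul1r.
have := convex_clamp fc aw1 aw0 tw01.
have -> : t / w * (a / w + 1) + (1 - t / w) * (a / w) = (a + t) / w.
  by field; rewrite gt_eqF.
move/(ler_wpM2r (ltW w0)) => H; apply: (le_trans H).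
by rewrite le_eqVlt; apply/orP; left; apply/eqP; field; rewrite gt_eqF.
Qed.

Lemma derivable_clamp (f : R -> R) t : 0 < t -> derivable f t 1 ->
  derivable (clamp f) t 1.
Proof.
move=> t0; apply: near_eq_derivable => //; near=> s.
by rewrite clampE //; apply: ltW; near: s; exact: lt_nbhsr.
Unshelve. all: by end_near. Qed.

Definition ent t := t * ln t - t + 1.

(** The left side is the tangent of [ent] at [a]. After division by [t] this is
    1 + ln (a / t) < a / t. *)
Lemma ent_tangent t a : 0 <= t -> 0 < a -> t != a ->
  t * ln a + 1 - a < ent t.
Proof.
rewrite le_eqVlt => /predU1P[<-|t0] a0 ta.
  by rewrite /ent !mul0r; lra.
have := @expR_gt1Dx R (ln (a / t)).
rewrite ln_eq0 ?divr_gt0 // lnK ?posrE ?divr_gt0 // ln_div ?posrE //.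
have -> : (a / t != 1).
  by apply: contra ta => /eqP H; rewrite -[a](divfK (lt0r_neq0 t0)) H mul1r.
move=> /(_ isT); rewrite ltr_pdivlMr // /ent => H; lra.
Qed.

Lemma ent_tangentW t a : 0 <= t -> 0 < a -> t * ln a + 1 - a <= ent t.
Proof.
move=> t0 a0; have [->|ta] := eqVneq t a; first by rewrite /ent; lra.
exact/ltW/ent_tangent.
Qed.

Lemma ent_strict_convex a b t : 0 <= a -> 0 <= b -> 0 < t < 1 -> a != b ->
  ent (t * a + (1 - t) * b) < t * ent a + (1 - t) * ent b.
Proof.
move=> a0 b0 /andP[t0 t1] ab; set m := t * a + (1 - t) * b.
have m0 : 0 < m.
  have t1' : 0 < 1 - t by rewrite subr_gt0.
  have [a0'|a0'] := eqVneq a 0.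
    rewrite /m a0' mulr0 add0r mulr_gt0 // lt0r b0 andbT.
    by apply: contra ab => /eqP ->; rewrite a0'.
  by rewrite /m ltr_pwDl ?mulr_ge0 ?(ltW t1') // mulr_gt0 // lt0r a0'.
have ma : a != m.
  apply: contra ab; rewrite -subr_eq0 => /eqP H.
  have : (1 - t) * (a - b) = 0 by rewrite -H /m; ring.
  move/eqP; rewrite mulf_eq0 subr_eq0 gt_eqF //=.
  by rewrite subr_eq0.
have Ha := ent_tangent a0 m0 ma.
have Hb := ent_tangentW b0 m0.
have E : ent m = t * (a * ln m + 1 - m) + (1 - t) * (b * ln m + 1 - m).
  by rewrite /ent {1}/m; ring.
rewrite E ltr_leD // ?ltr_pM2l // ler_wpM2l // subr_ge0 ltW //.
Qed.

Lemma convex_ent : convex_nonneg ent.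
Proof.
move=> a b t a0 b0 /andP[t0 t1].
have [->|ab] := eqVneq a b.
  have -> : t * b + (1 - t) * b = b by ring.
  lra.
have [->|t0'] := eqVneq t 0; first by rewrite !(mul0r,subr0,add0r,mul1r).
have [->|t1'] := eqVneq t 1; first by rewrite subrr !(mul0r,addr0,mul1r).
by apply/ltW/ent_strict_convex => //; rewrite !lt_neqAle t0 t1 eq_sym t0' t1'.
Qed.

Lemma perspective_ent_strict w a b t :
  0 < w -> 0 <= a -> 0 <= b -> 0 < t < 1 -> a != b ->
  clamp ent ((t * a + (1 - t) * b) / w) * w <
  t * (clamp ent (a / w) * w) + (1 - t) * (clamp ent (b / w) * w).
Proof.
move=> w0 a0 b0 /[dup] t01 /andP[/ltW t0 /ltW t1] ab.
rewrite !mulrA -mulrDl ltr_pM2r //.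
rewrite !clampE ?divr_ge0 ?addr_ge0 ?mulr_ge0 ?subr_ge0 ?(ltW w0) //.
rewrite [X in ent X](_ : _ = t * (a / w) + (1 - t) * (b / w)); last by ring.
apply: ent_strict_convex; rewrite ?divr_ge0 ?(ltW w0) //.
by apply: contra ab => /eqP /divIf H; apply/eqP/H; rewrite gt_eqF.
Qed.

Lemma derivable_ent t : 0 < t -> derivable ent t 1.
Proof.
move=> t0.
have ? := is_derive1_ln t0.
by rewrite (_ : ent = (id : R -> R) * @ln R - id + cst 1).
Qed.

(** At 0, lower semicontinuity follows from the tangent at a small point. *)
Lemma continuous_clamp_ent : continuous (clamp ent).
Proof.
apply: continuous_clamp; [exact: convex_ent|exact: derivable_ent|].
move=> e e0; have e20 : 0 < e / 2 by rewrite divr_gt0.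
have C0 : 0 < `|ln (e / 2)| + 1 by rewrite ltr_wpDl.
exists (e / 2 / (`|ln (e / 2)| + 1)); first by rewrite divr_gt0.
move=> t /andP[t0]; rewrite (ltr_pdivlMr _ _ C0) => te.
apply: lt_le_trans (ent_tangentW t0 e20).
rewrite /ent mul0r.
have : - (t * ln (e / 2)) <= t * `|ln (e / 2)|.
  by rewrite -mulrN ler_wpM2l // -normrN ler_norm.
lra.
Qed.

End HalfLine.

(** * One-variable derivatives *)

Section LineDerivatives.
Variable R : realType.

Lemma is_derive_sumr (J : Type) (r : seq J) (f : J -> R -> R) (l : J -> R)
    (x : R) :
  (forall j, is_derive x 1 (f j) (l j)) ->
  is_derive x 1 (fun t => \sum_(j <- r) f j t) (\sum_(j <- r) l j).
Proof.
move=> fl; elim: r => [|j r IH].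
  rewrite big_nil (_ : (fun=> _) = cst 0); first exact: is_derive_cst.
  by apply/funext => t; rewrite big_nil.
rewrite big_cons (_ : (fun=> _) = f j + (fun t => \sum_(j <- r) f j t)).
  exact: is_deriveD.
by apply/funext => t; rewrite big_cons.
Qed.

Lemma is_derive_affine (a b x : R) : is_derive x 1 (fun t => a + t * b) b.
Proof.
rewrite (_ : (fun=> _) = cst a + b \*: (id : R -> R)).
  by apply: is_derive_eq; rewrite /GRing.scale /= add0r mulr1.
by apply/funext => t; rewrite /= /cst /GRing.scale /=  mulrC.
Qed.

Lemma is_derive_perspective (f : R -> R) (a b m : R) : m != 0 ->
  derivable f (a / m) 1 ->
  is_derive (0 : R) 1 (fun t => f ((a + t * b) / m) * m) ('D_1 f (a / m) * b).
Proof.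
move=> m0 fd.
have gd : is_derive (0 : R) 1 (fun t => a / m + t * (b / m)) (b / m).
  exact: is_derive_affine.
have fd' : is_derive (a / m + 0 * (b / m)) 1 f ('D_1 f (a / m)).
  by rewrite mul0r addr0; exact: derivableP.
have := @is_derive1_comp R f (fun t => a / m + t * (b / m)) 0 _ _ fd' gd.
set h := f \o _ => hd.
rewrite (_ : (fun=> _) = m \*: h).
  by apply: is_derive_eq; rewrite /GRing.scale /=; field.
apply/funext => t; rewrite /h /= /GRing.scale /= mulrC; congr (_ * f _).
by field.
Qed.

Lemma is_derive_slope (f : R -> R) (l : R) : is_derive (0 : R) 1 f l ->
  t^-1 * (f t - f 0) @[t --> 0^'] --> l.
Proof.
case=> fd <-; rewrite /derive.
set g := (X in lim X).
have -> : (fun t => t^-1 * (f t - f 0)) =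
    (fun t => t^-1 *: ((f \o shift (0 : R)) (t *: 1) - f 0)).
  by apply/funext => t; rewrite /= /GRing.scale /= mulr1 addr0.
exact: fd.
Qed.

Lemma is_derive_descent (f : R -> R) (l : R) :
  is_derive (0 : R) 1 f l -> l < 0 ->
  exists2 t, 0 < t < 1 & f t < f 0.
Proof.
move=> /is_derive_slope fl l0.
have H : \forall t \near 0^'+, t^-1 * (f t - f 0) < 0.
  by have /cvg_dnbhs_at_right fr := fl; exact: (cvgr_lt _ fr).
near (0 : R)^'+ => t; have t0 : 0 < t by near: t; exact: nbhs_right_gt.
have : t^-1 * (f t - f 0) < 0 by near: t.
rewrite pmulr_rlt0 ?invr_gt0 // subr_lt0 => ft.
exists t => //; rewrite t0 /=; near: t; exact: nbhs_right_lt.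
Unshelve. all: by end_near. Qed.

Lemma is_derive_chord (f : R -> R) (l : R) : is_derive (0 : R) 1 f l ->
  (forall t, 0 <= t <= 1 -> f t <= f 0 + t * (f 1 - f 0)) -> l <= f 1 - f 0.
Proof.
move=> fl fc; rewrite leNgt; apply/negP => lt_l.
have : exists2 t, 0 < t < 1 & (- f t + t * (f 1 - f 0)) < - f 0.
  (* The chord minus f decreases at 0 as soon as l exceeds its slope. *)
  pose g := - f + (fun t => 0 + t * (f 1 - f 0)).
  have [] := @is_derive_descent g (- l + (f 1 - f 0)).
  - apply: is_deriveD; exact: is_derive_affine.
  - by rewrite addrC subr_lt0.
  - move=> t t01; rewrite /g => H; exists t => //.
    by move: H; rewrite !fctE; lra.
case=> t /andP[t0 t1]; have := fc t; rewrite (ltW t0) (ltW t1) => /(_ isT); lra.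
Qed.

End LineDerivatives.

(** * Continuity for pointwise convergence *)

Section PointwiseContinuity.
Variables (R : realType) (T : topologicalType).

Lemma continuous_eval (J : eqType) (j : J) :
  continuous (fun p : {ptws J -> R} => p j).
Proof. exact: proj_continuous. Qed.

Lemma continuous_ptws (J : choiceType) (f : T -> {ptws J -> R}) :
  (forall j, continuous (fun t => f t j)) -> continuous f.
Proof.
move=> fc t.
(* The criterion is stated over a topological index type; pointwise convergence
   ignores its topology, and any one will do. *)
apply: (@pointwise_cvgP (discrete_topology J : topologicalType) R
  (f @ t) (f t) _).2.
by move=> j; exact: fc.
Qed.

Lemma continuous_compose (U V : topologicalType) (F : T -> U) (G : U -> V) :
  continuous F -> continuous G -> continuous (fun t => G (F t)).
Proof. by move=> Fc Gc t; apply: continuous_comp; [exact: Fc|exact: Gc]. Qed.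

Lemma continuous_sumr (J : Type) (r : seq J) (F : J -> T -> R) :
  (forall j, continuous (F j)) -> continuous (fun t => \sum_(j <- r) F j t).
Proof.
move=> Fc; apply: (@continuous_big R J +%R 0 xpredT) => [|j _].
  exact: add_continuous.
exact: Fc.
Qed.

Lemma continuous_mull (k : R) (F : T -> R) :
  continuous F -> continuous (fun t => k * F t).
Proof. by move=> Fc t; apply: cvgMl_tmp; exact: Fc. Qed.

Lemma continuous_subr (F G : T -> R) :
  continuous F -> continuous G -> continuous (fun t => F t - G t).
Proof. by move=> Fc Gc t; apply: cvgB; [exact: Fc|exact: Gc]. Qed.

Lemma continuous_perspective (f : R -> R) (w : R) (F : T -> R) :
  continuous (clamp f) -> continuous F ->
  continuous (fun t => clamp f (F t / w) * w).
Proof.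
move=> fc Fc t; apply: cvgMr_tmp.
have : {for t, continuous (clamp f \o (fun t => F t / w))}; last by [].
apply: continuous_comp; last exact: fc.
by apply: cvgMr_tmp; exact: Fc.
Qed.

End PointwiseContinuity.

(** * Divergences as finite real sums *)

Section EntropyFunctions.
Variables (R : realType) (phi : R -> \bar R).
Hypothesis phi_entropy : entropy_function phi.
Hypothesis phi_fin : finite_on_nonneg phi.

Lemma convex_entropy : convex_nonneg (fine \o phi).
Proof.
move=> a b t a0 b0 /[dup] t01 /andP[t0 t1].
have := entropy_convex phi_entropy a b t01.
have s0 : 0 <= t * a + (1 - t) * b by rewrite addr_ge0 ?mulr_ge0 ?subr_ge0.
rewrite -(fineK (phi_fin a0)) -(fineK (phi_fin b0)) -(fineK (phi_fin s0)).
by rewrite -!EFinM -EFinD lee_fin.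
Qed.

Lemma derivable_entropy (phi_C1 : C1_on_interior_dom phi) t :
  0 < t -> derivable (fine \o phi) t 1.
Proof.
move=> t0; apply: (phi_C1 t _).1; near=> s.
have s0 : 0 < s by near: s; exact: lt_nbhsr.
have := phi_fin (ltW s0).
by rewrite fin_numElt => /andP[].
Unshelve. all: by end_near. Qed.

Lemma lsc_entropy e : 0 < e -> exists2 d, 0 < d &
  forall t, 0 <= t < d -> (fine \o phi) 0 - e < (fine \o phi) t.
Proof.
move=> e0.
have [|V] := entropy_lsc phi_entropy (x := 0) (a := fine (phi 0) - e).
  by rewrite -[ltRHS]fineK ?phi_fin // lte_fin ltrBlDr ltrDl.
move=> /nbhs_ballP[d /= d0 dV] Vphi; exists d => // t /andP[t0 td].
rewrite -lte_fin /= fineK ?phi_fin //; apply/Vphi/dV.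
by rewrite /ball /= sub0r normrN ger0_norm.
Qed.

Lemma continuous_clamp_entropy (phi_C1 : C1_on_interior_dom phi) :
  continuous (clamp (fine \o phi)).
Proof.
apply: continuous_clamp.
- exact: convex_entropy.
- exact: derivable_entropy.
- exact: lsc_entropy.
Qed.

(** Absolute continuity removes the singular part, hence the recession term. *)
Lemma divergenceE (Z : finType) (rho sigma : Z -> R) :
  Mplus rho -> Mplus sigma -> (forall z, sigma z = 0 -> rho z = 0) ->
  divergence phi rho sigma =
    (\sum_z clamp (fine \o phi) (rho z / sigma z) * sigma z)%:E.
Proof.
move=> rho0 sigma0 ac; rewrite /divergence.
have -> : mass (singular_part rho sigma) [set: Z]%SET = 0.
  by apply: big1 => z _; rewrite /singular_part; case: eqP => // /ac.
rewrite mule0 adde0 -sumEFin; apply: eq_bigr => z _.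
have d0 : 0 <= rho z / sigma z by rewrite divr_ge0.
by rewrite EFinM clampE //= fineK // phi_fin.
Qed.

End EntropyFunctions.

Lemma KLE (R : realType) (Z : finType) (rho sigma : Z -> R) :
  Mplus rho -> Mplus sigma -> (forall z, sigma z = 0 -> rho z = 0) ->
  KL rho sigma =
    (\sum_z clamp (@ent R) (rho z / sigma z) * sigma z)%:E.
Proof.
move=> rho0 sigma0 ac; rewrite /KL ifT.
  by congr (_%:E); apply: eq_bigr => z _; rewrite clampE ?divr_ge0.
apply/forallP => A; apply/implyP; rewrite /mass => /eqP mA.
apply/eqP/big1 => z zA; apply: ac.
have /eqP := mA; rewrite psumr_eq0 // => /allP/(_ z).
by rewrite mem_index_enum zA => /(_ isT)/eqP.
Qed.

(** * The score of a plan *)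

Section Marginals.
Variables (R : realType) (X Y : finType).
Implicit Types (p q h : X * Y -> R).

Lemma sum_pair (F : X * Y -> R) : \sum_z F z = \sum_x \sum_y F (x, y).
Proof. by rewrite pair_bigA; apply: eq_bigr => -[]. Qed.

Lemma marginalX_ge0 p : Mplus p -> Mplus (marginalX p).
Proof. by move=> p0 x; apply: sumr_ge0 => y _; apply: p0. Qed.

Lemma marginalY_ge0 p : Mplus p -> Mplus (marginalY p).
Proof. by move=> p0 y; apply: sumr_ge0 => x _; apply: p0. Qed.

Lemma marginalXD p h t x :
  marginalX (fun z => p z + t * h z) x = marginalX p x + t * marginalX h x.
Proof. by rewrite /marginalX big_split mulr_sumr. Qed.

Lemma marginalYD p h t y :
  marginalY (fun z => p z + t * h z) y = marginalY p y + t * marginalY h y.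
Proof. by rewrite /marginalY big_split mulr_sumr. Qed.

End Marginals.

Section Score.
Variables (R : realType) (X Y : finType) (mu : X -> R) (nu : Y -> R).
Variables (c : X * Y -> R) (eps : R) (f1 f2 : R -> R).
Hypotheses (mu_gt0 : full_support mu) (nu_gt0 : full_support nu).
Hypotheses (eps_gt0 : 0 < eps).
Hypotheses (f1_convex : convex_nonneg f1) (f2_convex : convex_nonneg f2).
Hypotheses (f1_ge0 : forall t, 0 <= t -> 0 <= f1 t).
Hypotheses (f2_ge0 : forall t, 0 <= t -> 0 <= f2 t).
Hypotheses (f1_cont : continuous (clamp f1)) (f2_cont : continuous (clamp f2)).
Hypotheses (f1_deriv : forall t, 0 < t -> derivable f1 t 1).
Hypotheses (f2_deriv : forall t, 0 < t -> derivable f2 t 1).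
Local Notation Z := (X * Y)%type.
Implicit Types (p q h : Z -> R).

Local Notation m := (product_measure mu nu).
Local Notation D f t := ('D_1 (clamp f) t).

Definition score p : R :=
  integral_against c p + eps * (\sum_z clamp (@ent R) (p z / m z) * m z)
  + (\sum_x clamp f1 (marginalX p x / mu x) * mu x)
  + (\sum_y clamp f2 (marginalY p y / nu y) * nu y).

Lemma product_measure_gt0 z : 0 < m z.
Proof. exact: mulr_gt0. Qed.

Definition mix t p q : Z -> R := fun z => t * p z + (1 - t) * q z.

Lemma mix_ge0 t p q : 0 <= t <= 1 -> Mplus p -> Mplus q -> Mplus (mix t p q).
Proof.
move=> /andP[t0 t1] p0 q0 z.
by rewrite /mix addr_ge0 ?mulr_ge0 ?subr_ge0 //; apply/p0 || apply/q0.
Qed.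

Lemma marginalX_mix t p q x :
  marginalX (mix t p q) x = t * marginalX p x + (1 - t) * marginalX q x.
Proof. by rewrite /marginalX /mix big_split /= !mulr_sumr. Qed.

Lemma marginalY_mix t p q y :
  marginalY (mix t p q) y = t * marginalY p y + (1 - t) * marginalY q y.
Proof. by rewrite /marginalY /mix big_split /= !mulr_sumr. Qed.

Lemma score_convex t p q : 0 <= t <= 1 -> Mplus p -> Mplus q ->
  score (mix t p q) <= t * score p + (1 - t) * score q.
Proof.
move=> t01 p0 q0; rewrite /score !mulrDr.
rewrite [leRHS]addrACA lerD //; last first.
  rewrite !mulr_sumr -big_split ler_sum // => y _; rewrite marginalY_mix.
  by apply: perspective_convex => //; apply: marginalY_ge0.
rewrite [leRHS]addrACA lerD //; last first.
  rewrite !mulr_sumr -big_split ler_sum // => x _; rewrite marginalX_mix.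
  by apply: perspective_convex => //; apply: marginalX_ge0.
rewrite [leRHS]addrACA lerD //.
  rewrite /integral_against !mulr_sumr -big_split ler_sum // => z _.
  by rewrite /mix /= mulrDr !mulrA (mulrC t) (mulrC (1 - t)).
rewrite !(mulrCA _ eps) -mulrDr ler_pM2l // !mulr_sumr -big_split.
apply: ler_sum => z _; apply: perspective_convex => //; first exact: convex_ent.
exact: product_measure_gt0.
Qed.

(** Strictness comes from the entropy alone: the marginals of distinct plans may
    coincide. *)
Lemma score_strict_convex t p q : 0 < t < 1 -> Mplus p -> Mplus q -> p <> q ->
  score (mix t p q) < t * score p + (1 - t) * score q.
Proof.
move=> /[dup] t01 /andP[t0 t1] p0 q0 pq.
have t01' : 0 <= t <= 1 by rewrite !ltW.
have [z0 pqz] : exists z, p z != q z.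
  apply: contrapT => /forallNP H; apply: pq; apply/funext => z.
  by apply/eqP; have /negP := H z; rewrite negbK.
rewrite /score !mulrDr.
rewrite [ltRHS]addrACA ltr_leD //; last first.
  rewrite !mulr_sumr -big_split ler_sum // => y _; rewrite marginalY_mix.
  by apply: perspective_convex => //; apply: marginalY_ge0.
rewrite [ltRHS]addrACA ltr_leD //; last first.
  rewrite !mulr_sumr -big_split ler_sum // => x _; rewrite marginalX_mix.
  by apply: perspective_convex => //; apply: marginalX_ge0.
rewrite [ltRHS]addrACA ler_ltD //.
  rewrite /integral_against !mulr_sumr -big_split ler_sum // => z _.
  by rewrite /mix /= mulrDr !mulrA (mulrC t) (mulrC (1 - t)).
rewrite !(mulrCA _ eps) -mulrDr ltr_pM2l // !mulr_sumr -big_split.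
(* The entropy term of an entry where p and q differ is strict. *)
rewrite (bigD1 z0) //= [ltRHS](bigD1 z0) //=.
have m0 := product_measure_gt0.
apply: ltr_leD.
  exact: perspective_ent_strict.
apply: ler_sum => z _.
by apply: perspective_convex => //; exact: convex_ent.
Qed.

(** Jensen's inequality with equal weights, adding one plan at a time. *)
Lemma score_average (J : Type) (r : seq J) (P : J -> Z -> R) :
  (0 < size r)%N -> (forall j, Mplus (P j)) ->
  score (fun z => (\sum_(j <- r) P j z) / (size r)%:R) <=
  (\sum_(j <- r) score (P j)) / (size r)%:R.
Proof.
move=> + P0; elim: r => // j r IH _; case: r IH => [_|j' r IH].
  rewrite big_seq1 divr1 (_ : (fun z => _) = P j) //.
  by apply/funext => z; rewrite big_seq1 divr1.
rewrite big_cons; set r' := j' :: r in IH *.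
rewrite (_ : size (j :: r') = (size r').+1) //.
set n := size r' in IH *; have n0 : (0 : R) < n%:R by rewrite ltr0n.
have n10 : (n.+1%:R : R) != 0 by rewrite pnatr_eq0.
pose t : R := n.+1%:R^-1.
have t01 : 0 <= t <= 1 by rewrite invr_ge0 ler0n invf_le1 ?ltr0n // ler1n.
have tE : 1 - t = n%:R / n.+1%:R.
  by apply: (mulIf n10); rewrite divfK // mulrBl mulVf // mul1r -natr1 addrK.
pose a z := (\sum_(j <- r') P j z) / n%:R.
have a0 : Mplus a.
  by move=> z; rewrite divr_ge0 // sumr_ge0 // => i _; exact: P0.
rewrite (_ : (fun z => _) = mix t (P j) a).
  apply: (le_trans (score_convex t01 (P0 j) a0)).
  have IH' := IH isT; rewrite -/a in IH'.
  have t0 : 0 <= 1 - t by rewrite tE divr_ge0.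
  have := ler_wpM2l t0 IH'; rewrite -(lerD2l (t * score (P j))).
  move=> /le_trans; apply.
  rewrite tE /t le_eqVlt; apply/orP; left; apply/eqP.
  by field; rewrite nat1r n10 gt_eqF.
apply/funext => z; rewrite /mix tE big_cons mulrDl mulrC; congr (_ + _).
by rewrite /a; field; rewrite nat1r n10 gt_eqF.
Qed.

Lemma continuous_score : continuous (score : {ptws Z -> R} -> R).
Proof.
have mX x : continuous (fun p : {ptws Z -> R} => marginalX p x).
  by apply: continuous_sumr => y; exact: continuous_eval.
have mY y : continuous (fun p : {ptws Z -> R} => marginalY p y).
  by apply: continuous_sumr => x; exact: continuous_eval.
have c1 : continuous (fun p : {ptws Z -> R} => integral_against c p).
  apply: continuous_sumr => z.
  by apply: continuous_mull; exact: continuous_eval.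
have c2 : continuous (fun p : {ptws Z -> R} =>
    eps * \sum_z clamp (@ent R) (p z / m z) * m z).
  apply: continuous_mull; apply: continuous_sumr => z.
  apply: continuous_perspective; first exact: continuous_clamp_ent.
  exact: continuous_eval.
have c3 : continuous (fun p : {ptws Z -> R} =>
    \sum_x clamp f1 (marginalX p x / mu x) * mu x).
  by apply: continuous_sumr => x; exact: continuous_perspective.
have c4 : continuous (fun p : {ptws Z -> R} =>
    \sum_y clamp f2 (marginalY p y / nu y) * nu y).
  by apply: continuous_sumr => y; exact: continuous_perspective.
move=> p; exact: cvgD (cvgD (cvgD (c1 p) (c2 p)) (c3 p)) (c4 p).
Qed.

(** The tangents of the entropy generator have arbitrarily large slopes, which
    beats any cost: the score grows at least like the total mass. *)
Lemma score_ge p : Mplus p ->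
  \sum_z (p z - eps * m z * (expR ((1 - c z) / eps) - 1)) <= score p.
Proof.
move=> p0; rewrite /score -addrA; apply: ler_wpDr.
  apply: addr_ge0; apply: sumr_ge0.
    move=> x _; rewrite mulr_ge0 ?(ltW (mu_gt0 x)) //.
    by rewrite f1_ge0 // le_max lexx orbT.
  move=> y _; rewrite mulr_ge0 ?(ltW (nu_gt0 y)) //.
  by rewrite f2_ge0 // le_max lexx orbT.
rewrite /integral_against mulr_sumr -big_split ler_sum // => z _ /=.
have m0 := product_measure_gt0 z.
have pm0 : 0 <= p z / m z by rewrite divr_ge0 // ?p0 ?ltW.
rewrite clampE //.
(* Slope (1 - c z) / eps leaves a coefficient 1 for p z. *)
have := ent_tangentW pm0 (expR_gt0 ((1 - c z) / eps)); rewrite expRK => H.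
have : p z / m z * ((1 - c z) / eps) * (eps * m z) = p z * (1 - c z).
  by field; rewrite !gt_eqF.
have em0 : 0 < eps * m z by rewrite mulr_gt0.
have := ler_wpM2r (ltW em0) H; lra.
Qed.

Lemma sublevel_bounded C : exists B, forall p z, Mplus p -> score p <= C ->
  0 <= p z <= B.
Proof.
exists (C + \sum_z eps * m z * (expR ((1 - c z) / eps) - 1)) => p z p0 pC.
rewrite p0 /= -lerBlDr; apply: le_trans pC; apply: le_trans (score_ge p0).
rewrite sumrB lerD2r (bigD1 z) //= lerDl.
by apply: sumr_ge0 => i _; apply: p0.
Qed.

Lemma closed_Mplus : closed (@Mplus R Z : set {ptws Z -> R}).
Proof.
rewrite (_ : @Mplus R Z = \bigcap_(z in [set: Z])
    ((fun p : {ptws Z -> R} => p z) @^-1` [set t | 0 <= t])).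
  apply: closed_bigI => z _; apply: closed_comp; last exact: closed_ge.
  by move=> p _; exact: continuous_eval.
by apply/seteqP; split => p p0 z; [move=> _; exact: p0|exact: p0].
Qed.

Lemma sublevel_compact C :
  compact ([set p | Mplus p /\ score p <= C] : set {ptws Z -> R}).
Proof.
have [B HB] := sublevel_bounded C.
have cbox : compact [set p : {ptws Z -> R} | forall z, `[0, B]%classic (p z)].
  apply: (@tychonoff Z (fun=> R) (fun=> `[0, B]%classic)) => _.
  exact: segment_compact.
apply: (subclosed_compact _ cbox).
  apply: closedI; first exact: closed_Mplus.
  have : closed ((score : {ptws Z -> R} -> R) @^-1` [set t | t <= C]).
    apply: closed_comp; last exact: closed_le.
    by move=> p _; exact: continuous_score.
  exact.
by move=> p [p0 pC] z; rewrite /= in_itv; exact: HB.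
Qed.

(** Existence by compactness of the sublevel sets; the midpoint of two minimizers
    would have a smaller score. *)
Lemma minimizer_closed_convex (A : set (Z -> R)) :
  A `<=` @Mplus R Z -> closed (A : set {ptws Z -> R}) -> A !=set0 ->
  (forall p q, A p -> A q -> A (mix 2^-1 p q)) ->
  exists2 p, A p & forall q, A q -> q <> p -> score p < score q.
Proof.
move=> A0 Acl [q0 Aq0] Amid.
set K := (A `&` [set p | Mplus p /\ score p <= score q0]) : set {ptws Z -> R}.
have Kc : compact K.
  rewrite /K setIC; apply: compact_closedI => //; exact: sublevel_compact.
have K0 : K !=set0 by exists q0; split => //; split => //; exact: A0.
have Fc : {within K, continuous (score : {ptws Z -> R} -> R)}.
  by apply: continuous_subspaceT; exact: continuous_score.
have [p + pmin] := compact_EVT_min K0 Kc Fc.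
rewrite inE => -[Ap _]; exists p => // q Aq qp.
have minp r : A r -> score p <= score r.
  move=> Ar; have [rq0|/ltW rq0] := leP (score r) (score q0).
    by apply: pmin; rewrite inE; split => //; split => //; exact: A0.
  apply: le_trans rq0; apply: pmin; rewrite inE; split => //.
  by split => //; exact: A0.
have h01 : 0 < (2^-1 : R) < 1 by rewrite invr_gt0 invf_lt1 ?ltr1n ?ltr0n.
have := score_strict_convex h01 (A0 _ Aq) (A0 _ Ap) qp.
have := minp _ (Amid q p Aq Ap); have := minp _ Aq; lra.
Qed.

(** * Improving a plan inside one block *)

Definition gradient p z : R :=
  c z + eps * D (@ent R) (p z / m z) + D f1 (marginalX p z.1 / mu z.1)
  + D f2 (marginalY p z.2 / nu z.2).

(** Positive entries keep every argument of the convex functions in the open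
    half-line, the inhabitants of [X] and [Y] serving to make the marginals
    positive. The derivative is linear in the direction [h]. *)
Lemma score_derive p h : (forall z, 0 < p z) -> (0 < #|X|)%N -> (0 < #|Y|)%N ->
  is_derive (0 : R) 1 (fun t => score (fun z => p z + t * h z))
    (\sum_z gradient p z * h z).
Proof.
move=> p0 /card_gt0P[x0 _] /card_gt0P[y0 _].
have m0 := product_measure_gt0.
have c1 : is_derive (0 : R) 1
    (fun t => integral_against c (fun z => p z + t * h z)) (\sum_z c z * h z).
  apply: is_derive_sumr => z.
  rewrite (_ : (fun t => _) = (fun t => c z * p z + t * (c z * h z))).
    exact: is_derive_affine.
  by apply/funext => t; ring.
have c2 : is_derive (0 : R) 1
    (eps \*: fun t => \sum_z clamp (@ent R) ((p z + t * h z) / m z) * m z)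
    (eps *: \sum_z D (@ent R) (p z / m z) * h z).
  apply: is_deriveZ; apply: is_derive_sumr => z.
  apply: is_derive_perspective; first by rewrite gt_eqF.
  have pm : 0 < p z / m z by rewrite divr_gt0.
  by apply: derivable_clamp => //; apply: derivable_ent.
have c3 : is_derive (0 : R) 1
    (fun t => \sum_x clamp f1 (marginalX (fun z => p z + t * h z) x / mu x) * mu x)
    (\sum_x D f1 (marginalX p x / mu x) * marginalX h x).
  apply: is_derive_sumr => x.
  under eq_fun do rewrite marginalXD.
  apply: is_derive_perspective; first by rewrite gt_eqF.
  have pm : 0 < marginalX p x / mu x.
    rewrite divr_gt0 //; apply: lt_le_trans (p0 (x, y0)) _.
    by rewrite /marginalX (bigD1 y0) //= lerDl sumr_ge0 // => y _; apply: ltW.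
  by apply: derivable_clamp => //; apply: f1_deriv.
have c4 : is_derive (0 : R) 1
    (fun t => \sum_y clamp f2 (marginalY (fun z => p z + t * h z) y / nu y) * nu y)
    (\sum_y D f2 (marginalY p y / nu y) * marginalY h y).
  apply: is_derive_sumr => y.
  under eq_fun do rewrite marginalYD.
  apply: is_derive_perspective; first by rewrite gt_eqF.
  have pm : 0 < marginalY p y / nu y.
    rewrite divr_gt0 //; apply: lt_le_trans (p0 (x0, y)) _.
    by rewrite /marginalY (bigD1 x0) //= lerDl sumr_ge0 // => x _; apply: ltW.
  by apply: derivable_clamp => //; apply: f2_deriv.
have d := is_deriveD (is_deriveD (is_deriveD c1 c2) c3) c4.
refine (@is_derive_eq _ _ _ _ _ _ _ _ d _).
under [RHS]eq_bigr do rewrite /gradient !mulrDl.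
rewrite !big_split /=; congr (_ + _ + _ + _).
- by rewrite /GRing.scale /= mulr_sumr; apply: eq_bigr => z _; rewrite mulrA.
- by rewrite sum_pair; apply: eq_bigr => x _; rewrite mulr_sumr.
- by rewrite sum_pair exchange_big; apply: eq_bigr => y _; rewrite mulr_sumr.
Qed.

(** Raising one entry affects one term of each sum. *)
Lemma score_bump p z0 t :
  score (fun z => p z + t * (z == z0)%:R) - score p =
  c z0 * t
  + eps * ((clamp (@ent R) ((p z0 + t) / m z0) - clamp (@ent R) (p z0 / m z0))
           * m z0)
  + (clamp f1 ((marginalX p z0.1 + t) / mu z0.1)
     - clamp f1 (marginalX p z0.1 / mu z0.1)) * mu z0.1
  + (clamp f2 ((marginalY p z0.2 + t) / nu z0.2)
     - clamp f2 (marginalY p z0.2 / nu z0.2)) * nu z0.2.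
Proof.
have only (J : finType) (j : J) (F : J -> R) :
    (forall i, i != j -> F i = 0) -> \sum_i F i = F j.
  by move=> F0; rewrite (bigD1 j) //= big1 ?addr0.
have mX x : marginalX (fun z => (z == z0)%:R) x = (x == z0.1)%:R :> R.
  case: z0 => x0 y0; rewrite /marginalX (only _ y0) /= => [|y /negbTE ny].
    by rewrite xpair_eqE eqxx andbT.
  by rewrite xpair_eqE ny andbF.
have mY y : marginalY (fun z => (z == z0)%:R) y = (y == z0.2)%:R :> R.
  case: z0 {mX} => x0 y0; rewrite /marginalY (only _ x0) /= => [|x /negbTE nx].
    by rewrite xpair_eqE eqxx.
  by rewrite xpair_eqE nx.
pose p' z := p z + t * (z == z0)%:R.
rewrite -/p' [LHS](_ : _ =
  \sum_z (c z * p' z - c z * p z)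
  + eps * (\sum_z (clamp (@ent R) (p' z / m z) * m z
                   - clamp (@ent R) (p z / m z) * m z))
  + \sum_x (clamp f1 (marginalX p' x / mu x) * mu x
            - clamp f1 (marginalX p x / mu x) * mu x)
  + \sum_y (clamp f2 (marginalY p' y / nu y) * nu y
            - clamp f2 (marginalY p y / nu y) * nu y)); last first.
  by rewrite !sumrB /score /integral_against; ring.
rewrite (only _ z0) /p' => [|z /negbTE ->]; last by rewrite mulr0 addr0 subrr.
rewrite (only _ z0) => [|z /negbTE ->]; last by rewrite mulr0 addr0 subrr.
rewrite (only _ z0.1) => [|x /negbTE nx]; last first.
  by rewrite marginalXD mX nx mulr0 addr0 subrr.
rewrite (only _ z0.2) => [|y /negbTE ny]; last first.
  by rewrite marginalYD mY ny mulr0 addr0 subrr.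
rewrite marginalXD marginalYD mX mY !eqxx mulr1; ring.
Qed.

(** The entropy has slope -oo at 0, whereas the increments of the other terms are
    at most linear. *)
Lemma score_descent_at_zero p z0 : Mplus p -> p z0 = 0 ->
  exists2 t, 0 < t & score (fun z => p z + t * (z == z0)%:R) < score p.
Proof.
move=> p0 pz0.
have m0 := product_measure_gt0 z0.
set a := marginalX p z0.1; set b := marginalY p z0.2.
set C1 := clamp f1 (a / mu z0.1 + 1) - clamp f1 (a / mu z0.1).
set C2 := clamp f2 (b / nu z0.2 + 1) - clamp f2 (b / nu z0.2).
set B := (c z0 + C1 + C2) / eps.
(* The other terms grow at most like t (c z0 + C1 + C2) = t eps B, and the
   entropy like t (ln (t / m z0) - 1); at this t the logarithm is at most - B. *)
set t := Num.min (m z0 * expR (- B)) (Num.min (mu z0.1) (nu z0.2)).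
have t0 : 0 < t by rewrite !lt_min mulr_gt0 ?expR_gt0 //= mu_gt0 nu_gt0.
exists t => //; rewrite -subr_lt0 score_bump pz0 mul0r add0r -/a -/b.
have H1 : (clamp f1 ((a + t) / mu z0.1) - clamp f1 (a / mu z0.1)) * mu z0.1
    <= t * C1.
  rewrite mulrBl lerBlDl perspective_slope //; first exact: marginalX_ge0.
  by rewrite (ltW t0) /= /t !ge_min lexx orbT.
have H2 : (clamp f2 ((b + t) / nu z0.2) - clamp f2 (b / nu z0.2)) * nu z0.2
    <= t * C2.
  rewrite mulrBl lerBlDl perspective_slope //; first exact: marginalY_ge0.
  by rewrite (ltW t0) /= /t !ge_min lexx !orbT.
have H3 : ln (t / m z0) <= - B.
  rewrite -(expRK (- B)) ler_ln ?posrE ?expR_gt0 ?divr_gt0 //.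
  by rewrite ler_pdivrMr // mulrC /t ge_min lexx.
have H4 : (clamp (@ent R) (t / m z0) - clamp (@ent R) 0) * m z0
    <= t * (- B - 1).
  rewrite !clampE ?divr_ge0 ?(ltW t0) ?(ltW m0) // /ent mul0r subr0 add0r addrK.
  rewrite [leLHS](_ : _ = t * (ln (t / m z0) - 1)); last first.
    by field; rewrite gt_eqF.
  by rewrite ler_pM2l // lerD2r.
have H5 := ler_wpM2l (ltW eps_gt0) H4.
have EB : eps * (t * (- B - 1)) = - t * (c z0 + C1 + C2) - t * eps.
  by rewrite /B; field; rewrite gt_eqF.
have : 0 < t * eps by rewrite mulr_gt0.
lra.
Qed.

(** Optimality within each block implies optimality: zeros of [p] are excluded by
    the entropy, and at a positive plan the derivative towards [q] is the sum of
    the derivatives along its restrictions to the blocks. *)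
Lemma blockwise_descent (J : finType) (k : X -> J) p q :
  Mplus p -> Mplus q -> score q < score p ->
  exists j r,
    [/\ Mplus r, forall z, k z.1 != j -> r z = p z & score r < score p].
Proof.
move=> p0 q0 qp.
have [[z0 pz0]|pn0] := pselect (exists z, p z = 0).
  have [t t0 ht] := score_descent_at_zero p0 pz0.
  exists (k z0.1), (fun z => p z + t * (z == z0)%:R); split => //.
    by move=> z; rewrite addr_ge0 // ?mulr_ge0 ?(ltW t0) //; exact: p0.
  move=> z kz; rewrite (_ : (z == z0) = false) ?mulr0 ?addr0 //.
  by apply: contraNF kz => /eqP ->.
have {}pn0 z : 0 < p z.
  by rewrite lt0r p0 andbT; apply/eqP => H; apply: pn0; exists z.
(* Both factors are inhabited since p and q differ somewhere; this is what makes
   the marginals of p positive. *)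
have [X0 Y0] : (0 < #|X|)%N /\ (0 < #|Y|)%N.
  have : exists z : Z, p z != q z.
    apply: contrapT => H; move: qp; rewrite (_ : p = q) ?ltxx //.
    apply/funext => z; apply/eqP; apply: contrapT => /negP pqz.
    by apply: H; exists z.
  by case=> -[x y] _; split; apply/card_gt0P; [exists x|exists y].
pose h z := q z - p z.
pose hj j z := (k z.1 == j)%:R * h z.
have dh : \sum_z gradient p z * h z < 0.
  have := is_derive_chord (score_derive h pn0 X0 Y0).
  have p0E : (fun z => p z + 0 * h z) = p.
    by apply/funext => z; rewrite mul0r addr0.
  have p1E : (fun z => p z + 1 * h z) = q.
    by apply/funext => z; rewrite /h mul1r addrC subrK.
  rewrite p0E p1E => H; apply: le_lt_trans (H _) _; last by rewrite subr_lt0.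
  move=> t t01; rewrite (_ : (fun z => _) = mix t q p).
    by have := score_convex t01 q0 p0; lra.
  by apply/funext => z; rewrite /mix /h; ring.
have hE : \sum_z gradient p z * h z = \sum_j \sum_z gradient p z * hj j z.
  rewrite exchange_big; apply: eq_bigr => z _.
  rewrite -mulr_sumr; congr (_ * _); rewrite (bigD1 (k z.1)) //= big1.
    by rewrite /hj eqxx mul1r addr0.
  by move=> j nj; rewrite /hj eq_sym (negbTE nj) mul0r.
have [j hj0] : exists j, \sum_z gradient p z * hj j z < 0.
  apply: contrapT => /forallNP H; move: dh.
  rewrite hE ltNge sumr_ge0 // => j _.
  by rewrite leNgt; apply/negP/H.
have [t /andP[t0 t1] ht] :=
  is_derive_descent (score_derive (hj j) pn0 X0 Y0) hj0.
exists j, (fun z => p z + t * hj j z); split.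
- move=> z; rewrite /hj; case: eqP => _; last first.
    by rewrite mul0r mulr0 addr0; exact: p0.
  rewrite mul1r (_ : _ + _ = (1 - t) * p z + t * q z); last by rewrite /h; ring.
  by rewrite addr_ge0 // mulr_ge0 ?subr_ge0 ?(ltW t0) ?(ltW t1).
- by move=> z /negbTE kz; rewrite /hj kz mul0r mulr0 addr0.
- apply: (lt_le_trans ht); rewrite (_ : (fun z => _) = p) //.
  by apply/funext => z; rewrite mul0r addr0.
Qed.

Definition overwrite (S : {set X}) p q : Z -> R :=
  fun z => if z.1 \in S then q z else p z.

Lemma overwrite_ge0 (S : {set X}) p q :
  Mplus p -> Mplus q -> Mplus (overwrite S p q).
Proof.
by move=> p0 q0 z; rewrite /overwrite; case: ifP => _; [exact: q0|exact: p0].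
Qed.

Lemma overwrite_id (S : {set X}) p : overwrite S p p = p.
Proof. by apply/funext => z; rewrite /overwrite if_same. Qed.

Lemma continuous_overwrite (S : {set X}) q :
  continuous ((fun p => overwrite S p q) : {ptws Z -> R} -> {ptws Z -> R}).
Proof.
apply: (@continuous_ptws R {ptws Z -> R} Z (fun p => overwrite S p q)) => z.
rewrite /overwrite; case: (z.1 \in S); first exact: cst_continuous.
exact: continuous_eval.
Qed.

(** The replacement [r] is kept fixed while [u] varies near [p], so the gain is a
    continuous function of [u]. *)
Lemma uniform_block_gain (J : finType) (k : X -> J) p q :
  Mplus p -> Mplus q -> score q < score p ->
  exists j r, Mplus r /\ exists2 d : R, 0 < d &
    nbhs (p : {ptws Z -> R})
      [set u | d <= score u - score (overwrite [set x | k x == j]%SET u r)].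
Proof.
move=> p0 q0 qp; have [j [r [r0 rp rlt]]] := blockwise_descent k p0 q0 qp.
exists j, r; split => //; exists ((score p - score r) / 2).
  by rewrite divr_gt0 // subr_gt0.
set S := [set x | k x == j]%SET.
have gp : overwrite S p r = r.
  apply/funext => z; rewrite /overwrite inE; case: ifPn => // kz.
  by rewrite rp.
have cg : continuous
    (fun u : {ptws Z -> R} => score u - score (overwrite S u r)).
  apply: continuous_subr; first exact: continuous_score.
  apply: continuous_compose (continuous_score).
  exact: continuous_overwrite.
have := cvgr_ge _ (cg p) ((score p - score r) / 2).
rewrite gp; apply; rewrite ltr_pdivrMr // mulr_natr mulr2n ltrDl subr_gt0 //.
Qed.

(** * Convergence of descent sequences *)

(** The scores are monotone and bounded, so their decrements vanish and every
    accumulation point is optimal. Compactness of the sublevel sets provides one,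
    and strictness of the minimum then draws in the whole sequence. *)
Lemma descent_converges (u : nat -> Z -> R) (popt : Z -> R) :
  (forall n, Mplus (u n)) -> Mplus popt ->
  (forall q, Mplus q -> q <> popt -> score popt < score q) ->
  (forall n, score (u n.+1) <= score (u n)) ->
  (forall p, Mplus p -> p <> popt -> exists2 d, 0 < d &
     exists2 V, nbhs (p : {ptws Z -> R}) V &
       forall n, V (u n) -> d <= score (u n) - score (u n.+1)) ->
  {ptws, u n @[n --> \oo] --> popt}.
Proof.
move=> u0 popt0 poptmin udecr gain.
pose v n := score (u n).
have vdecr : nonincreasing_seq v by apply/nonincreasing_seqP.
have vlb n : score popt <= v n.
  rewrite /v; have [<-//|un] := pselect (u n = popt).
  by apply/ltW/poptmin.
have vcvg : cvgn v.
  apply: nonincreasing_is_cvgn => //.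
  by exists (score popt) => _ [n _ <-].
have dv : (v n - v n.+1) @[n --> \oo] --> (0 : R).
  rewrite -(subrr (limn v)); apply: cvgB => //.
  by have := vcvg; rewrite -(cvg_shiftS v).
set K := [set p | Mplus p /\ score p <= v 0%N] : set {ptws Z -> R}.
have Kc : compact K by exact: sublevel_compact.
have Ku n : K (u n) by split; [exact: u0|exact: vdecr].
pose ufil : set_system {ptws Z -> R} := u n @[n --> \oo].
have [p [[p0 _] pclu]] : K `&` cluster ufil !=set0.
  by apply: Kc; exists 0%N => // n _; exact: Ku.
have infinitely_often V N : nbhs (p : {ptws Z -> R}) V ->
    exists2 n, (N <= n)%N & V (u n).
  move=> Vp.
  have [||_ [[n Nn <-] Vn]] := pclu (u @` [set n | (N <= n)%N]) V => //.
    by exists N => // n Nn; exists n.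
  by exists n.
(* Near a non-optimal p the decrements stay above d, while they tend to 0. *)
have popt_p : p = popt.
  apply: contrapT => /(gain p p0)[d d0 [V Vp Vd]].
  have [N _ HN] := cvgr_lt _ dv _ d0.
  have [n Nn Vn] := infinitely_often V N Vp.
  by have := HN n Nn; rewrite ltNge Vd.
(* Off a neighbourhood W of popt the compact sublevel set keeps the score above
   that of some q; the monotone scores fall below it infinitely often, hence
   forever. *)
move=> U; rewrite nbhsE => -[W [oW Wpopt] WU].
suff [N HN] : exists N, forall n, (N <= n)%N -> W (u n).
  by exists N => // n Nn; apply/WU/HN.
have KWc : compact (K `\` W) by apply: compact_closedI => //; exact: open_closedC.
have [KW0|/set0P KW0] := eqVneq (K `\` W) set0.
  exists 0%N; move=> n _; apply: contrapT => Wn.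
  by have : (K `\` W) (u n) by []; rewrite KW0.
have Fc : {within K `\` W, continuous (score : {ptws Z -> R} -> R)}.
  by apply: continuous_subspaceT; exact: continuous_score.
have [q + qmin] := compact_EVT_min KW0 KWc Fc.
rewrite inE => -[[q0 _] Wq].
have qpopt : score popt < score q.
  by apply: poptmin => // qp; apply: Wq; rewrite qp.
have near_p : nbhs (p : {ptws Z -> R}) [set r | score r < score q].
  have := cvgr_lt _ (@continuous_score p).
  by apply; rewrite popt_p.
have [N _ HN] := infinitely_often _ 0%N near_p.
exists N; move=> n Nn; apply: contrapT => Wn.
have : score q <= v n by apply: qmin; rewrite inE.
by rewrite leNgt (le_lt_trans (vdecr _ _ Nn)).
Qed.

End Score.

(** * Cell problems *)

Section DomainDecompositionTheory.
Variables (R : realType) (X Y I : finType).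
Variables (mu : X -> R) (nu : Y -> R) (c : X * Y -> R) (eps : R).
Variables (phi1 phi2 : R -> \bar R) (Xi : I -> {set X}).
Hypotheses (mu_supp : full_support mu) (nu_supp : full_support nu).
Hypothesis eps_gt0 : 0 < eps.
Hypotheses (phi1_entropy : entropy_function phi1)
           (phi2_entropy : entropy_function phi2).
Hypotheses (phi1_ge0 : nonnegative phi1) (phi2_ge0 : nonnegative phi2).
Hypotheses (phi1_fin : finite_on_nonneg phi1)
           (phi2_fin : finite_on_nonneg phi2).
Hypotheses (phi1_C1 : C1_on_interior_dom phi1)
           (phi2_C1 : C1_on_interior_dom phi2).
Hypothesis Xi_partition : basic_partition mu Xi.

Local Notation Z := (X * Y)%type.
Local Notation E := (objective c eps mu nu phi1 phi2).
Local Notation F := (score mu nu c eps (fine \o phi1) (fine \o phi2)).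
Local Notation m := (product_measure mu nu).
Local Notation cell := (composite_cell Xi).
Local Notation sol := (cell_solution c eps mu nu phi1 phi2 Xi).
Local Notation next := (next_plan c eps mu nu phi1 phi2 Xi).
Implicit Types (p q r : Z -> R) (S : {set X}).
Implicit Types (J : {set I}) (JJ : {set {set I}}).

Let m_gt0 z : 0 < m z. Proof. exact: product_measure_gt0. Qed.
Let f1_convex : convex_nonneg (fine \o phi1). Proof. exact: convex_entropy. Qed.
Let f2_convex : convex_nonneg (fine \o phi2). Proof. exact: convex_entropy. Qed.
Let f1_ge0 t : 0 <= t -> 0 <= (fine \o phi1) t.
Proof. by move=> _; apply: fine_ge0; exact: phi1_ge0. Qed.
Let f2_ge0 t : 0 <= t -> 0 <= (fine \o phi2) t.
Proof. by move=> _; apply: fine_ge0; exact: phi2_ge0. Qed.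
Let f1_cont : continuous (clamp (fine \o phi1)).
Proof. exact: continuous_clamp_entropy. Qed.
Let f2_cont : continuous (clamp (fine \o phi2)).
Proof. exact: continuous_clamp_entropy. Qed.
Let f1_deriv t : 0 < t -> derivable (fine \o phi1) t 1.
Proof. exact: derivable_entropy. Qed.
Let f2_deriv t : 0 < t -> derivable (fine \o phi2) t 1.
Proof. exact: derivable_entropy. Qed.

Lemma in_cylinder S z : (z \in cylinder Y S) = (z.1 \in S).
Proof. by rewrite /cylinder finset.inE [z.2 \in _]finset.inE andbT. Qed.

Lemma objectiveE p : Mplus p -> E p = (F p)%:E.
Proof.
move=> p0; rewrite /objective KLE //; first last.
- by move=> z mz; have := m_gt0 z; rewrite mz ltxx.
- by move=> z; rewrite ltW.
rewrite divergenceE //; first last.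
- by move=> x mx; have := mu_supp x; rewrite mx ltxx.
- by move=> x; rewrite ltW.
- exact: marginalX_ge0.
rewrite divergenceE //; first last.
- by move=> x mx; have := nu_supp x; rewrite mx ltxx.
- by move=> x; rewrite ltW.
- exact: marginalY_ge0.
Qed.

Lemma sum_split (T : finType) (P : pred T) (f g h : T -> R) :
  (forall t, P t -> f t = g t) -> (forall t, ~~ P t -> f t = h t) ->
  (forall t, ~~ P t -> g t = 0) ->
  \sum_t g t = \sum_t f t - \sum_(t | ~~ P t) h t.
Proof.
move=> fg fh g0; rewrite (bigID P) /= [X in _ + X = _]big1 // addr0.
rewrite [in RHS](bigID P) /= [X in _ + X - _](eq_bigr h) // addrK.
by apply: eq_bigr => t /fg.
Qed.

Definition off_cell_score S p : R :=
  \sum_(z : Z | z.1 \notin S) c z * p z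
  + eps * (\sum_(z : Z | z.1 \notin S) clamp (@ent R) (p z / m z) * m z)
  + \sum_(x | x \notin S) clamp (fine \o phi1) (marginalX p x / mu x) * mu x.

(** Outside the cell the overwritten plan and its first marginal are those of [p],
    whose terms form the constant; the second marginal adds up to [nuJ] plus that
    of [q]. *)
Lemma cell_objectiveE J p q : Mplus p -> Mplus_on (cylinder Y (cell J)) q ->
  cell_objective c eps mu nu phi1 phi2 Xi J
    (marginalY (restriction p (cylinder Y (~: cell J)%SET))) q =
  (F (overwrite (cell J) p q) - off_cell_score (cell J) p)%:E.
Proof.
move=> p0 [q0 qoff]; rewrite /cell_objective; set S := cell J.
set nuJ := marginalY (restriction _ _); set muJ := restriction mu S.
have {}qoff z : z.1 \notin S -> q z = 0.
  by move=> zS; apply: qoff; rewrite in_cylinder.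
have muJ0 x : x \notin S -> muJ x = 0.
  by rewrite /muJ /restriction => /negbTE ->.
have muJE x : x \in S -> muJ x = mu x by rewrite /muJ /restriction => ->.
have muJ_eq0 x : muJ x = 0 -> x \notin S.
  rewrite /muJ /restriction; case: ifP => // _ mx.
  by have := mu_supp x; rewrite mx ltxx.
have muJ_ge0 : Mplus muJ.
  by move=> x; rewrite /muJ /restriction; case: ifP => // _; rewrite ltW.
have mqoff x : x \notin S -> marginalX q x = 0.
  by move=> xS; rewrite /marginalX big1 // => y _; exact: qoff.
rewrite KLE //; first last.
- move=> z /eqP; rewrite /product_measure mulf_eq0 (gt_eqF (nu_supp _)) orbF.
  by move=> /eqP /muJ_eq0 /qoff.
- by move=> z; rewrite mulr_ge0 // ?ltW //; exact: muJ_ge0.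
rewrite divergenceE //; first last.
- by move=> x /muJ_eq0 /mqoff.
- exact: marginalX_ge0.
have YE y : marginalY q y + nuJ y = marginalY (overwrite S p q) y.
  have -> : marginalY (overwrite S p q) y =
      \sum_x (q (x, y) + restriction p (cylinder Y (~: S)%SET) (x, y)).
    apply: eq_bigr => x _.
    rewrite /overwrite /restriction in_cylinder finset.inE /=.
    by case: ifPn => xS /=; [rewrite addr0|rewrite qoff ?add0r].
  by rewrite big_split.
rewrite (_ : (fun y => _) = marginalY (overwrite S p q)); last exact/funext.
rewrite divergenceE //; first last.
- by move=> y my; have := nu_supp y; rewrite my ltxx.
- by move=> y; rewrite ltW.
- by apply: marginalY_ge0; exact: overwrite_ge0.
rewrite -EFinM -!EFinD; congr (_%:E).
rewrite /score /off_cell_score /integral_against.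
have ovE z : z.1 \in S -> overwrite S p q z = q z by rewrite /overwrite => ->.
have ovN z : z.1 \notin S -> overwrite S p q z = p z.
  by rewrite /overwrite => /negbTE ->.
have mXE x : x \in S -> marginalX (overwrite S p q) x = marginalX q x.
  by move=> xS; apply: eq_bigr => y _; rewrite ovE.
have mXN x : x \notin S -> marginalX (overwrite S p q) x = marginalX p x.
  by move=> xS; apply: eq_bigr => y _; rewrite ovN.
rewrite (@sum_split _ (fun z : Z => z.1 \in S)
    (fun z => c z * overwrite S p q z)
    (fun z => c z * q z) (fun z => c z * p z)); first last.
- by move=> z /qoff ->; rewrite mulr0.
- by move=> z /ovN ->.
- by move=> z /ovE ->.
rewrite (@sum_split _ (fun z : Z => z.1 \in S)
    (fun z => clamp (@ent R) (overwrite S p q z / m z) * m z)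
    (fun z => clamp (@ent R) (q z / product_measure muJ nu z)
              * product_measure muJ nu z)
    (fun z => clamp (@ent R) (p z / m z) * m z)); first last.
- by move=> z zS; rewrite /product_measure muJ0 // mul0r mulr0.
- by move=> z /ovN ->.
- by move=> z zS; rewrite ovE // /product_measure muJE.
rewrite (@sum_split _ (fun x => x \in S)
    (fun x => clamp (fine \o phi1) (marginalX (overwrite S p q) x / mu x)
              * mu x)
    (fun x => clamp (fine \o phi1) (marginalX q x / muJ x) * muJ x)
    (fun x => clamp (fine \o phi1) (marginalX p x / mu x) * mu x)); first last.
- by move=> x xS; rewrite muJ0 // mulr0.
- by move=> x /mXN ->.
- by move=> x xS; rewrite mXE // muJE.
ring.
Qed.

Lemma closed_eq_off S p :
  closed ([set r | forall z, z.1 \notin S -> r z = p z] : set {ptws Z -> R}).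
Proof.
rewrite (_ : [set r | _] = \bigcap_(z in [set z : Z | z.1 \notin S])
    ((fun r : {ptws Z -> R} => r z) @^-1` [set p z])) //.
apply: closed_bigI => z _; apply: closed_comp; last exact: closed_eq.
by move=> r _; exact: continuous_eval.
Qed.

(** The plans on the cell correspond to the plans that agree with [p] off the cell,
    a closed convex set; the cell objective and the score order them alike. *)
Lemma cell_solutionP J p : Mplus p ->
  Mplus_on (cylinder Y (cell J)) (sol J p) /\
  forall r, Mplus r -> (forall z, z.1 \notin cell J -> r z = p z) ->
    r <> overwrite (cell J) p (sol J p) ->
    F (overwrite (cell J) p (sol J p)) < F r.
Proof.
move=> p0; set S := cell J.
pose A := [set r | Mplus r /\ forall z : Z, z.1 \notin S -> r z = p z].
have [rmin [rmin0 rminp] rminlt] :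
    exists2 r, A r & forall q, A q -> q <> r -> F r < F q.
  apply: minimizer_closed_convex => //.
  - by move=> r [].
  - by apply: closedI; [exact: closed_Mplus|exact: closed_eq_off].
  - by exists p.
  - move=> r s [r0 rp] [s0 sp]; split; first by apply: mix_ge0 => //; lra.
    by move=> z zS; rewrite /mix rp // sp //; ring.
pose s := restriction rmin (cylinder Y S).
have sin : Mplus_on (cylinder Y S) s.
  split=> [z|z zS]; rewrite /s /restriction; first by case: ifP.
  by rewrite (negbTE zS).
have ov_s : overwrite S p s = rmin.
  apply/funext => z; rewrite /overwrite /s /restriction in_cylinder.
  by have [zS|zS] := boolP (z.1 \in S); [|rewrite rminp].
have ovA q : Mplus_on (cylinder Y S) q -> A (overwrite S p q).
  move=> [q0 _]; split; first exact: overwrite_ge0.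
  by move=> z zS; rewrite /overwrite (negbTE zS).
have [solS solmin] : argmin (cell_objective c eps mu nu phi1 phi2 Xi J
    (marginalY (restriction p (cylinder Y (~: S)%SET))))
    (Mplus_on (cylinder Y S)) (sol J p).
  apply: xgetPex; exists s; split => // q qin.
  rewrite !cell_objectiveE // lee_fin lerD2r -/S ov_s.
  have [->//|/rminlt H] := pselect (overwrite S p q = rmin).
  exact/ltW/H/ovA.
split => // r r0 rp.
have -> : overwrite S p (sol J p) = rmin; last by apply: rminlt.
apply: contrapT => /(rminlt _ (ovA _ solS)).
apply/negP; rewrite -leNgt -ov_s.
by have := solmin s sin; rewrite !cell_objectiveE // lee_fin lerD2r.
Qed.

(** With full support, essentially disjoint sets are disjoint. *)
Lemma basic_cells_disjoint i i' x : x \in Xi i -> x \in Xi i' -> i = i'.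
Proof.
case: Xi_partition => _ disj _ xi xi'; apply/eqP/negPn/negP => ii'.
have := disj i i' ii'; rewrite /mass (bigD1 x) ?inE ?xi ?xi' //=.
move=> /eqP; rewrite gt_eqF // ltr_pwDl // sumr_ge0 // => y _; exact: ltW.
Qed.

Lemma cell_index JJ : composite_partition JJ ->
  exists k : X -> cells JJ,
    forall x (J : cells JJ), (x \in cell (val J)) = (k x == J).
Proof.
move=> JJpart; have [JJcover JJtriv _] := and3P JJpart.
have cell_unique x (J J' : cells JJ) :
    x \in cell (val J) -> x \in cell (val J') -> J = J'.
  move=> /bigcupP[i iJ xi] /bigcupP[i' iJ' xi'].
  rewrite -(basic_cells_disjoint xi xi') in iJ'.
  apply/val_inj; rewrite -(def_pblock JJtriv (valP J) iJ).
  by rewrite -(def_pblock JJtriv (valP J') iJ').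
have /choice[k kP] : forall x, exists J : cells JJ, x \in cell (val J).
  move=> x; have : x \in [set: X]%SET by [].
  case: Xi_partition => <- _ _ /bigcupP[i _ xi].
  have icover : i \in finset.cover JJ by rewrite (eqP JJcover) inE.
  exists (exist _ (finset.pblock JJ i) (pblock_mem icover)).
  by apply/bigcupP; exists i => //=; rewrite mem_pblock.
exists k => x J; apply/idP/eqP => [xJ|<-//].
exact: cell_unique (kP x) xJ.
Qed.

(** * The updated plans *)

Lemma updated_planE JJ p (theta : cells JJ -> R) (k : X -> cells JJ) :
  (forall x (J : cells JJ), (x \in cell (val J)) = (k x == J)) -> Mplus p ->
  updated_plan (cell_restrictions Xi JJ p)
      (cell_solutions c eps mu nu phi1 phi2 Xi JJ p) theta =
  fun z => (1 - theta (k z.1)) * p z + theta (k z.1) * sol (val (k z.1)) p z.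
Proof.
move=> kE p0; apply/funext => z; rewrite /updated_plan (bigD1 (k z.1)) //= big1.
  by rewrite addr0 /cell_restrictions /restriction in_cylinder kE eqxx.
move=> J nJ; have zJ : z \notin cylinder Y (cell (val J)).
  by rewrite in_cylinder kE eq_sym.
rewrite /cell_restrictions /restriction (negbTE zJ) /cell_solutions.
by rewrite (cell_solutionP (val J) p0).1.2 // !mulr0 addr0.
Qed.

Lemma card_cells JJ : #|{: cells JJ}| = #|JJ|.
Proof. by rewrite card_sig; apply: eq_card. Qed.

(** At a point of a given cell, one of the n overwritten plans shows the cell
    solution and the n - 1 others show [p]. *)
Lemma next_safe_average JJ p : composite_partition JJ -> Mplus p ->
  (0 < #|JJ|)%N ->
  next weights_safe JJ p = fun z =>
    (\sum_(J : cells JJ) overwrite (cell (val J)) p (sol (val J) p) z)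
    / #|JJ|%:R.
Proof.
move=> /cell_index[k kE] p0 JJ0; rewrite /next_plan (updated_planE _ kE p0).
have n0 : #|JJ|%:R != 0 :> R by rewrite pnatr_eq0 -lt0n.
apply/funext => z; rewrite /weights_safe (bigD1 (k z.1)) //= /overwrite kE eqxx.
rewrite (eq_bigr (fun=> p z)); last first.
  by move=> J nJ; rewrite kE eq_sym (negbTE nJ).
rewrite sumr_const (_ : #|_| = #|JJ|.-1); last first.
  by rewrite -card_cells (cardC1 (k z.1)).
rewrite -[p z *+ _]mulr_natr -subn1 natrB //; field.
by [].
Qed.

(** Jensen's inequality for the average, in which the plan overwritten on [J] scores
    at most as much as [r] does there and the other ones at most as much as [p]. *)
Lemma next_safe_gain JJ p r (J : cells JJ) :
  composite_partition JJ -> Mplus p -> Mplus r ->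
  F (next weights_safe JJ p) <=
    F p - (F p - F (overwrite (cell (val J)) p r)) / #|JJ|%:R.
Proof.
move=> JJpart p0 r0.
have JJ0 : (0 < #|JJ|)%N by rewrite -card_cells; apply/card_gt0P; exists J.
have n0 : #|JJ|%:R != 0 :> R by rewrite pnatr_eq0 -lt0n.
pose P (K : cells JJ) := overwrite (cell (val K)) p (sol (val K) p).
have P0 K : Mplus (P K).
  by apply: overwrite_ge0 => //; exact: (cell_solutionP (val K) p0).1.1.
have Pmin K s : Mplus s -> F (P K) <= F (overwrite (cell (val K)) p s).
  move=> s0; have [->//|H] := pselect (overwrite (cell (val K)) p s = P K).
  apply/ltW/((cell_solutionP (val K) p0).2 _ _ _ H); first exact: overwrite_ge0.
  by move=> z zK; rewrite /overwrite (negbTE zK).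
have sizeE : size (enum {: cells JJ}) = #|JJ| by rewrite -cardE card_cells.
have := @score_average R X Y mu nu c eps (fine \o phi1) (fine \o phi2)
  mu_supp nu_supp eps_gt0 f1_convex f2_convex _ (enum {: cells JJ}) P.
rewrite sizeE big_enum => /(_ JJ0 P0) avg.
rewrite next_safe_average //; under eq_fun do rewrite -big_enum.
apply: (le_trans avg); rewrite (bigD1 J) //=.
have rest : \sum_(K | K != J) F (P K) <= (#|JJ|%:R - 1) * F p.
  apply: (@le_trans _ _ (\sum_(K : cells JJ | K != J) F p)).
    apply: ler_sum => K _.
    by rewrite -[p in leRHS](overwrite_id (cell (val K))); exact: Pmin.
  rewrite sumr_const (cardC1 J) card_cells.
  by rewrite -[F p *+ _]mulr_natl -subn1 natrB.
have := Pmin J r r0; rewrite ler_pdivrMr ?ltr0n //.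
rewrite mulrBl divfK //; lra.
Qed.

Lemma next_safe_le JJ p : composite_partition JJ -> Mplus p ->
  F (next weights_safe JJ p) <= F p.
Proof.
move=> JJpart p0; have [k kE] := cell_index JJpart.
have [J|noJ] := pickP (fun _ : cells JJ => true).
  move=> _; have := next_safe_gain J JJpart p0 p0.
  by rewrite overwrite_id subrr mul0r subr0.
(* Without cells X is empty, and there is only one plan. *)
rewrite (_ : next weights_safe JJ p = p) //; apply/funext => z.
by have /= := noJ (k z.1).
Qed.

Lemma next_safe_lt JJ p : composite_partition JJ -> Mplus p ->
  ~ (forall J : cells JJ, cell_restrictions Xi JJ p J =
       cell_solutions c eps mu nu phi1 phi2 Xi JJ p J) ->
  F (next weights_safe JJ p) < F p.
Proof.
move=> JJpart p0 /existsNP[J nJ].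
have [[s0 soff] smin] := cell_solutionP (val J) p0.
have JJ0 : (0 < #|JJ|)%N by rewrite -card_cells; apply/card_gt0P; exists J.
apply: (le_lt_trans (next_safe_gain J JJpart p0 s0)).
rewrite ltrBlDr ltrDl divr_gt0 ?ltr0n // subr_gt0; apply: smin => // pE.
apply: nJ; apply/funext => z.
rewrite /cell_restrictions /cell_solutions /restriction.
case: ifPn => [|/soff ->//]; rewrite in_cylinder => zJ.
by rewrite {1}pE /overwrite zJ.
Qed.

Definition weights01 (GW : weight_function R X Y I) JJ p := forall J : cells JJ,
  0 <= GW JJ (cell_restrictions Xi JJ p)
          (cell_solutions c eps mu nu phi1 phi2 Xi JJ p) J <= 1.

Lemma next_ge0 GW JJ p : composite_partition JJ -> Mplus p ->
  weights01 GW JJ p -> Mplus (next GW JJ p).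
Proof.
move=> /cell_index[k kE] p0 GW01 z; rewrite /next_plan (updated_planE _ kE p0).
have /andP[t0 t1] := GW01 (k z.1).
rewrite addr_ge0 // mulr_ge0 ?subr_ge0 //.
exact: (cell_solutionP (val (k z.1)) p0).1.1.
Qed.

Lemma safe_weight01 JJ : 0 <= (#|JJ|%:R^-1 : R) <= 1.
Proof.
rewrite invr_ge0 ler0n /=; case: #|JJ| => [|n]; first by rewrite invr0.
by rewrite invf_le1 ?ltr0n // ler1n.
Qed.

Lemma weights_better_than_safe (GW : weight_function R X Y I) JJ p :
  is_weights_swift c eps mu nu phi1 phi2 Xi GW \/
  is_weights_opt c eps mu nu phi1 phi2 Xi GW \/
  is_weights_line c eps mu nu phi1 phi2 Xi GW ->
  composite_partition JJ -> Mplus p ->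
  weights01 GW JJ p /\ (E (next GW JJ p) <= E (next weights_safe JJ p))%E.
Proof.
move=> GWopt JJpart p0.
have radm : admissible Xi (cell_restrictions Xi JJ p).
  move=> J; split=> [z|z zJ]; rewrite /cell_restrictions /restriction.
    by case: ifP.
  by rewrite (negbTE zJ).
have sadm : admissible Xi (cell_solutions c eps mu nu phi1 phi2 Xi JJ p).
  by move=> J; exact: (cell_solutionP (val J) p0).1.
have [s0 s1] := andP (safe_weight01 JJ).
case: GWopt => [|[]] /(_ JJ _ _ JJpart radm sadm) [GWin GWmin]; split.
- rewrite /weights01; case: GWin => -> J; first exact: safe_weight01.
  by rewrite /weights_one ler01 lexx.
- by apply: GWmin; left.
- exact: GWin.
- by apply: GWmin => J; exact: safe_weight01.
- rewrite /weights01; case: GWin => zeta /andP[z0 z1] -> J; rewrite z1 andbT.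
  exact: le_trans z0.
- by apply: GWmin; exists #|JJ|%:R^-1; rewrite ?lexx.
Qed.

Lemma iterates_converge (GW : weight_function R X Y I) JA JB p :
  composite_partition JA -> composite_partition JB -> Mplus p ->
  (forall JJ q, composite_partition JJ -> Mplus q ->
     weights01 GW JJ q /\ (E (next GW JJ q) <= E (next weights_safe JJ q))%E) ->
  exists popt, argmin E (@Mplus R Z) = [set popt] /\
    {ptws, iterates c eps mu nu phi1 phi2 Xi GW JA JB p k @[k --> \oo]
           --> popt}.
Proof.
move=> JApart JBpart p0 GWok.
set u := iterates _ _ _ _ _ _ _ _ _ _ _.
pose JJ n := if odd n then JA else JB.
have JJpart n : composite_partition (JJ n) by rewrite /JJ; case: odd.
have u0 n : Mplus (u n).
  elim: n => [//|n IH]; apply: (next_ge0 (JJpart n.+1) IH).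
  exact: (GWok _ _ (JJpart n.+1) IH).1.
have safe0 K q : composite_partition K -> Mplus q ->
    Mplus (next weights_safe K q).
  by move=> Kpart q0; apply: next_ge0 => // J; exact: safe_weight01.
have ustep n : F (u n.+1) <= F (next weights_safe (JJ n.+1) (u n)).
  have := (GWok _ _ (JJpart n.+1) (u0 n)).2.
  have u0' : Mplus (next GW (JJ n.+1) (u n)) := u0 n.+1.
  by rewrite !objectiveE //; exact: safe0.
have [popt popt0 poptmin] : exists2 r, @Mplus R Z r &
    forall q, Mplus q -> q <> r -> F r < F q.
  apply: minimizer_closed_convex => //; first exact: closed_Mplus.
    by exists p.
  by move=> r s r0 s0; apply: mix_ge0 => //; lra.
exists popt; split.
  apply/seteqP; split => [q [q0 qmin]|_ ->].
    apply: contrapT => /(poptmin q q0); apply/negP; rewrite -leNgt -lee_fin.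
    by rewrite -!objectiveE //; exact: qmin.
  split => // q q0; rewrite !objectiveE // lee_fin.
  by have [->//|/poptmin H] := pselect (q = popt); apply/ltW/H.
apply: (descent_converges mu_supp nu_supp eps_gt0
  (f1 := fine \o phi1) (f2 := fine \o phi2) (c := c)) => //.
  by move=> n; apply: le_trans (ustep n) _; apply: next_safe_le.
move=> q q0 qpopt.
have cell_gain K : composite_partition K -> exists2 d, 0 < d &
    exists2 V, nbhs (q : {ptws Z -> R}) V & forall v, Mplus v -> V v ->
      d <= F v - F (next weights_safe K v).
  move=> Kpart; have [k kE] := cell_index Kpart.
  have [J [r [r0 [d d0 Vq]]]] := uniform_block_gain mu_supp nu_supp eps_gt0
    f1_convex f2_convex f1_cont f2_cont f1_deriv f2_deriv k q0 popt0
    (poptmin q q0 qpopt).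
  have n0 : (0 : R) < #|K|%:R.
    by rewrite ltr0n -card_cells; apply/card_gt0P; exists J.
  exists (d / #|K|%:R); first by rewrite divr_gt0.
  exists [set v | d <= F v - F (overwrite (cell (val J)) v r)].
    rewrite (_ : cell (val J) = [set x | k x == J]%SET) //.
    by apply/setP => x; rewrite inE kE.
  move=> v v0 /= dv; have := next_safe_gain J Kpart v0 r0.
  have : d / #|K|%:R <= (F v - F (overwrite (cell (val J)) v r)) / #|K|%:R.
    by rewrite ler_pM2r ?invr_gt0.
  lra.
(* The parity of a step selects the partition, so take a gain valid for both. *)
have [dA dA0 [VA VAq HA]] := cell_gain JA JApart.
have [dB dB0 [VB VBq HB]] := cell_gain JB JBpart.
exists (Num.min dA dB); first by rewrite lt_min dA0.
exists (VA `&` VB); first exact: filterI.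
move=> n [VAu VBu].
apply: le_trans
  (_ : _ <= F (u n) - F (next weights_safe (JJ n.+1) (u n))) _.
  by rewrite /JJ; case: odd; rewrite ge_min; [rewrite HA|rewrite HB ?orbT].
by rewrite lerD2l lerN2.
Qed.

End DomainDecompositionTheory.

Theorem proposition3p13 (R : realType) (X Y I : finType)
    (mu : X -> R) (nu : Y -> R) (c : X * Y -> R) (eps : R)
    (phi1 phi2 : R -> \bar R) (Xi : I -> {set X})
    (mu_supp : full_support mu) (nu_supp : full_support nu) (eps_gt0 : 0 < eps)
    (phi1_entropy : entropy_function phi1) (phi2_entropy : entropy_function phi2)
    (phi1_ge0 : nonnegative phi1) (phi2_ge0 : nonnegative phi2)
    (phi1_fin : finite_on_nonneg phi1) (phi2_fin : finite_on_nonneg phi2)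
    (phi1_C1 : C1_on_interior_dom phi1) (phi2_C1 : C1_on_interior_dom phi2)
    (Xi_partition : basic_partition mu Xi) :
  let E := objective c eps mu nu phi1 phi2 in
  let restr := cell_restrictions Xi in
  let sol := cell_solutions c eps mu nu phi1 phi2 Xi in
  let next := next_plan c eps mu nu phi1 phi2 Xi in
  let iter := iterates c eps mu nu phi1 phi2 Xi in
  let swift := is_weights_swift c eps mu nu phi1 phi2 Xi in
  let opt := is_weights_opt c eps mu nu phi1 phi2 Xi in
  let line := is_weights_line c eps mu nu phi1 phi2 Xi in
  [/\ continuous_weights Xi (weights_safe : weight_function R X Y I) /\
      (forall (pi : X * Y -> R) (JJ : {set {set I}}),
         Mplus pi -> composite_partition JJ ->
         ~ (forall J : cells JJ, restr JJ pi J = sol JJ pi J) ->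
         (E (next weights_safe JJ pi) < E pi)%E),
      (forall GW : weight_function R X Y I, swift GW \/ opt GW \/ line GW ->
       forall (pi : X * Y -> R) (JJ : {set {set I}}),
         Mplus pi -> composite_partition JJ ->
         (E (next GW JJ pi) <= E (next weights_safe JJ pi))%E) &
      (forall GW : weight_function R X Y I,
         [\/ GW = weights_safe, swift GW, opt GW | line GW] ->
       forall (JA JB : {set {set I}}) (pi_init : X * Y -> R),
         composite_partition JA -> composite_partition JB ->
         Mplus pi_init -> (E pi_init < +oo)%E ->
         exists pi_opt : X * Y -> R,
           argmin E (@Mplus R (X * Y)%type) = [set pi_opt] /\
           {ptws, iter GW JA JB pi_init k @[k --> \oo] --> pi_opt})].
Proof.
move=> E restr sol next iter swift opt line.
have better GW JJ p : swift GW \/ opt GW \/ line GW ->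
    composite_partition JJ -> Mplus p ->
    weights01 mu nu c eps phi1 phi2 Xi GW JJ p /\
    (E (next GW JJ p) <= E (next weights_safe JJ p))%E.
  exact: weights_better_than_safe.
split.
- split; first by move=> JJ _; apply: continuous_subspaceT; exact: cst_continuous.
  move=> p JJ p0 JJpart nstat.
  have next0 : Mplus (next weights_safe JJ p).
    by apply: next_ge0 => // J; exact: safe_weight01.
  by rewrite /E !objectiveE // lte_fin; apply: next_safe_lt.
- by move=> GW hGW p JJ p0 JJpart; exact: (better GW JJ p hGW JJpart p0).2.
- move=> GW hGW JA JB p JApart JBpart p0 _.
  apply: iterates_converge => // JJ q JJpart q0.
  case: hGW => [->|h|h|h]; [|apply: better; tauto..].
  by split => [J|]; [exact: safe_weight01|].
Qed.
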